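(* Assume the following. (i) $\Theta\subset\mathbb{R}^s$ is convex and compact with nonempty interior. (ii) There are constants $c_1\ge c_2>0$ such that the prior density satisfies $c_1\ge p(\theta)\ge c_2$ for all $\theta\in\Theta$. (iii) For every $(\xi,\eta)\in\Xi\times\mathcal{H}$, $f(\xi|\eta,\theta)>0$ for all $\theta\in\Theta$. (iv) For every $(\xi,\eta)\in\Xi\times\mathcal{H}$, $\theta\mapsto f(\xi|\eta,\theta)$ is continuous on $\Theta$. (v) The Markov chain $\{\eta_t\}_{t\ge1}$ is irreducible and aperiodic. (vi) $\log f(\xi|\eta,\theta)$, $\theta\in\Theta$, is dominated by an integrable function with respect to $P^*$. (vii) The model is correctly specified and identifiable at a parameter $\theta^*\in\mathrm{int}(\Theta)$: $q(\cdot|\eta)=f(\cdot|\eta,\theta^* )$ for all $\eta\in\mathcal{H}$, and whenever $\theta'\in\Theta$ satisfies $f(\cdot|\eta,\theta^* )=f(\cdot|\eta,\theta')$ for all $\eta\in\mathcal{H}$, then $\theta'=\theta^*$. Then $V_N^*$ converges to $V^*$ uniformly on $\mathcal{X}\times\mathcal{H}$ as $N\to\infty$, $\mathbb{P}^*$-almost surely; that is, $\|V_N^*-V^*\|_\infty=\sup_{(x,\eta)\in\mathcal{X}\times\mathcal{H}}|V_N^*(x,\eta)-V^*(x,\eta)|\to0$ as $N\to\infty$, $\mathbb{P}^*$-almost surely.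
   Context: Data and learning. $\mathcal{H}$ is a finite set and $\{\eta_t\}_{t\ge1}$ is a time-homogeneous Markov chain on $\mathcal{H}$ with transition probabilities $\varpi_{h,h'}=\mathbb{P}(\eta_{t+1}=h'|\eta_t=h)$ and deterministic $\eta_1$. $\Xi\subset\mathbb{R}^d$ is closed. Conditional on $\eta_t$, the random vector $\xi_t\in\Xi$ has density $q(\cdot|\eta_t)$ and is conditionally independent of the past; also $\eta_{t+1}$ conditional on $\eta_t$ is independent of $(\xi_1,\dots,\xi_t)$; and $\xi_i$ is conditionally independent of $\xi_1,\dots,\xi_{i-1}$ given $\{\eta_i\}_{i=1}^N$. $\mathbb{P}^*$ denotes the law of this true data-generating process $\{(\xi_t,\eta_t)\}_{t\ge1}$. $\{f(\cdot|\eta,\theta):\theta\in\Theta\}$, $\eta\in\mathcal{H}$, is a parametric family of probability densities on $\Xi$, with $\Theta\subset\mathbb{R}^s$, and $p$ is a prior density on $\Theta$. The posterior density given $(\xi_i,\eta_i)$, $i=1,\dots,N$, is $$\mathsf{p}_N(\theta)=\frac{\mathsf{f}_N(\theta)p(\theta)}{\int_\Theta \mathsf{f}_N(\vartheta)p(\vartheta)\,\mathrm{d}\vartheta},\qquad \mathsf{f}_N(\theta)=f(\xi_1|\eta_1,\theta)\prod_{i=2}^N\big[f(\xi_i|\eta_i,\theta)\varpi_{\eta_{i-1},\eta_i}\big].$$ $\nu_\eta$ denotes the stationary distribution of the chain $\{\eta_t\}$, and $P^*$ is the stationary one-period law $\mathrm{d}P^*(\xi,\eta)=\nu_\eta(\eta)q(\xi|\eta)\,\mathrm{d}\xi$.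 Control problem. $\gamma\in(0,1)$ is a discount factor; $\mathcal{X}\subset\mathbb{R}^n$ is the state space; $\mathcal{U}\subset\mathbb{R}^m$ is a nonempty control set; $c:\mathbb{R}^n\times\mathbb{R}^m\times\mathbb{R}^d\to\mathbb{R}$ is measurable and bounded on $\mathcal{X}\times\mathcal{U}\times\Xi$; $F:\mathbb{R}^n\times\mathbb{R}^m\times\mathbb{R}^d\to\mathbb{R}^n$ is measurable with $F(\mathcal{X}\times\mathcal{U}\times\Xi)\subset\mathcal{X}$. Write $\mathbb{E}_{\eta'|\eta}[V(y,\eta')]=\sum_{\eta'\in\mathcal{H}}\varpi_{\eta,\eta'}V(y,\eta')$. In the paper's setting the following two Bellman equations have unique bounded solutions on $\mathcal{X}\times\mathcal{H}$. The true value function $V^*$ is the unique bounded solution of $$V(x,\eta)=\inf_{u\in\mathcal{U}}\mathbb{E}_{\xi\sim q(\cdot|\eta)}\Big[c(x,u,\xi)+\gamma\,\mathbb{E}_{\eta'|\eta}[V(F(x,u,\xi),\eta')]\Big].$$ The Bayesian value function $V_N^*$ is the unique bounded solution of $$V(x,\eta)=\inf_{u\in\mathcal{U}}\mathbb{E}_{\mathsf{p}_N|\eta}\Big[c(x,u,\xi)+\gamma\,\mathbb{E}_{\eta'|\eta}[V(F(x,u,\xi),\eta')]\Big],$$ where for bounded $Y$, $\mathbb{E}_{\mathsf{p}_N|\eta}[Y]=\int_\Theta\int_\Xi Y(\xi)f(\xi|\eta,\theta)\mathsf{p}_N(\theta)\,\mathrm{d}\xi\,\mathrm{d}\theta$.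 *)

(* Defs.v *)
From HB Require Import structures.
From mathcomp Require Import all_boot all_order all_algebra.
From mathcomp Require Import all_classical all_reals all_analysis.
From mathcomp Require Import measurable_realfun.
Set Implicit Arguments.
Unset Strict Implicit.
Unset Printing Implicit Defensive.
Import Order.TTheory GRing.Theory Num.Theory.
Import numFieldNormedType.Exports.
Local Open Scope classical_set_scope.
Local Open Scope ring_scope.

HB.instance Definition _ (R : realType) (n : nat) :=
  @isMeasurable.Build default_measure_display 'rV[R]_n <<s @open 'rV[R]_n >>
    (@sigma_algebra0 _ setT (@open 'rV[R]_n))
    (@sigma_algebraC _ (@open 'rV[R]_n))
    (@sigma_algebra_bigcup _ setT (@open 'rV[R]_n)).

Lemma measurable_fun_rV (R : realType) d (T : measurableType d) n
    (f : T -> 'rV[R]_n) :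
  (forall i, measurable_fun setT (fun x => f x ord0 i)) ->
  measurable_fun setT f.
Proof.
move=> mf.
apply: (@measurability _ _ _ _ setT f (@open 'rV[R]_n)) => //.
move=> _ [B oB <-]; rewrite setTI.
pose box (k : {ffun 'I_n -> rat * rat}) : set 'rV[R]_n :=
  [set v | forall i, v ord0 i \in `]ratr (k i).1, ratr (k i).2[%R].
have -> : f @^-1` B =
    \bigcup_(k in [set k | box k `<=` B]) (f @^-1` box k).
  apply/seteqP; split => [x Bfx|x [k /= kO]]; last exact: kO.
  have /nbhs_ballP[e /= e0 eO] : nbhs (f x) B by exact: open_nbhs_nbhs.
  have /choice[a aP] : forall i, exists q : rat,
      ratr q \in `](f x ord0 i - e), (f x ord0 i)[%R.
    by move=> i; apply: rat_in_itvoo; rewrite ltrBlDr ltrDl.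
  have /choice[b bP] : forall i, exists q : rat,
      ratr q \in `](f x ord0 i), (f x ord0 i + e)[%R.
    by move=> i; apply: rat_in_itvoo; rewrite ltrDl.
  exists [ffun i => (a i, b i)] => /=.
    move=> v vb; apply: eO; split => // i j; rewrite ord1.
    have := vb j; rewrite ffunE/= in_itv/= => /andP[av vb'].
    have := aP j; have := bP j; rewrite !in_itv/= => /andP[b1 b2] /andP[a1 a2].
    rewrite /ball/= ltr_norml; apply/andP; split.
      by rewrite ltrNl opprB ltrBlDr addrC (lt_trans vb')// .
    by rewrite ltrBlDr addrC -ltrBlDr (lt_trans a1)//.
  move=> i; rewrite ffunE/= in_itv/=.
  have := aP i; have := bP i; rewrite !in_itv/= => /andP[b1 _] /andP[_ a2].
  by rewrite a2 b1.
rewrite bigcup_mkcond; apply: countable_bigcupT_measurable => // k.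
case: ifP => // _.
have -> : f @^-1` box k = \bigcap_i
    ((fun x => f x ord0 i) @^-1` `]ratr (k i).1, ratr (k i).2[%classic).
  by apply/seteqP; split => [x bx i _|x bx i]; [exact: bx|exact: (bx i I)].
apply: fin_bigcap_measurable => // i _.
by rewrite -[X in measurable X]setTI; exact: mf.
Qed.

Lemma measurable_coord_rV (R : realType) n (i : 'I_n) :
  measurable_fun setT (fun v : 'rV[R]_n => v ord0 i).
Proof.
apply: (measurability _ (RGenOInfty.measurableE R)) => //=.
move=> _ [_ [a ->] <-]; rewrite setTI; apply: sub_sigma_algebra.
by apply: open_comp; [move=> + _; exact: coord_continuous|exact: interval_open].
Qed.

Section lebesgue_rV.
Variable R : realType.

Definition cons_rV n (z : R * 'rV[R]_n) : 'rV[R]_n.+1 :=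
  \row_i oapp (z.2 ord0) z.1 (unlift ord0 i).

Definition uncons_rV n (v : 'rV[R]_n.+1) : R * 'rV[R]_n :=
  (v ord0 ord0, \row_i v ord0 (lift ord0 i)).

Lemma cons_rVK n : cancel (@cons_rV n) (@uncons_rV n).
Proof.
move=> [x v]; congr pair; first by rewrite mxE unlift_none.
by apply/rowP => i; rewrite !mxE liftK.
Qed.

Lemma measurable_cons_rV n : measurable_fun setT (@cons_rV n).
Proof.
apply: measurable_fun_rV => i; under eq_fun do rewrite mxE.
case: unliftP => [j|] _ /=; last exact: measurable_fst.
exact: (measurableT_comp (measurable_coord_rV j) measurable_snd).
Qed.

Lemma measurable_uncons_rV n : measurable_fun setT (@uncons_rV n).
Proof.
apply: measurable_fun_pair; first exact: measurable_coord_rV.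
apply: measurable_fun_rV => i; under eq_fun do rewrite mxE.
exact: measurable_coord_rV.
Qed.

Section step.
Variables (n : nat) (mu : {sigma_finite_measure set 'rV[R]_n -> \bar R}).

Definition lebesgue_cons : set 'rV[R]_n.+1 -> \bar R :=
  pushforward (lebesgue_measure \x mu)%E (@cons_rV n).

Let lebesgue_cons0 : lebesgue_cons set0 = 0%E.
Proof. by rewrite /lebesgue_cons /pushforward preimage_set0 measure0. Qed.

Let lebesgue_cons_ge0 A : (0 <= lebesgue_cons A)%E.
Proof. by rewrite /lebesgue_cons /pushforward measure_ge0. Qed.

Let lebesgue_cons_sigma_additive : semi_sigma_additive lebesgue_cons.
Proof.
move=> F mF tF mUF; rewrite /lebesgue_cons /pushforward preimage_bigcup.
apply: measure_semi_sigma_additive.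
- by move=> k; rewrite -[X in measurable X]setTI; exact: measurable_cons_rV.
- apply/trivIsetP => /= i j _ _ ij; rewrite -preimage_setI.
  by move/trivIsetP : tF => /(_ _ _ _ _ ij) ->//; rewrite preimage_set0.
- by rewrite -preimage_bigcup -[X in measurable X]setTI;
    exact: measurable_cons_rV.
Qed.

HB.instance Definition _ := isMeasure.Build _ _ _ lebesgue_cons
  lebesgue_cons0 lebesgue_cons_ge0 lebesgue_cons_sigma_additive.

Let lebesgue_cons_sigma_finite : sigma_finite setT lebesgue_cons.
Proof.
have /sigma_finiteP[F [FT ndF Foo]] := sigma_finiteT (@lebesgue_measure R).
have /sigma_finiteP[G [GT ndG Goo]] := sigma_finiteT mu.
exists (fun k => @uncons_rV n @^-1` (F k `*` G k)).
  apply/seteqP; split => // v _ /=.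
  have [i _ Fi] : (\bigcup_i F i) (uncons_rV v).1 by rewrite -FT.
  have [j _ Gj] : (\bigcup_i G i) (uncons_rV v).2 by rewrite -GT.
  exists (maxn i j) => //; split.
    by move: Fi; exact/subsetPset/ndF/leq_maxl.
  by move: Gj; exact/subsetPset/ndG/leq_maxr.
move=> k; have [mF Fk] := Foo k; have [mG Gk] := Goo k; split.
  rewrite -[X in measurable X]setTI.
  by apply: measurable_uncons_rV => //; exact: measurableX.
rewrite /lebesgue_cons /pushforward -comp_preimage.
rewrite (_ : _ \o _ = id); last by apply/funext => z; exact: cons_rVK.
by rewrite preimage_id product_measure1E// lte_mul_pinfty// ge0_fin_numE.
Qed.

HB.instance Definition _ := Measure_isSigmaFinite.Build _ _ _ lebesgue_cons
  lebesgue_cons_sigma_finite.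

End step.

Fixpoint lebesgue_rV n : {sigma_finite_measure set 'rV[R]_n -> \bar R} :=
  match n return {sigma_finite_measure set 'rV[R]_n -> \bar R} with
  | 0 => dirac (0 : 'rV[R]_0)
  | n'.+1 => lebesgue_cons (lebesgue_rV n')
  end.

Lemma lebesgue_rV_prod n (A : 'I_n -> set R) :
  (forall i, measurable (A i)) ->
  lebesgue_rV n [set v | forall i, A i (v ord0 i)] =
  (\prod_(i < n) lebesgue_measure (A i))%E.
Proof.
elim: n A => [|n IH] A mA.
  by rewrite big_ord0 /= diracE mem_set// => -[].
set B := [set v : 'rV[R]_n | forall i, A (lift ord0 i) (v ord0 i)].
have mB : measurable B.
  rewrite (_ : B = \bigcap_i
      ((fun v : 'rV[R]_n => v ord0 i) @^-1` A (lift ord0 i))); last first.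
    by apply/seteqP; split => [v Av i _|v Av i]; [exact: Av|exact: (Av i I)].
  apply: fin_bigcap_measurable => // i _.
  by rewrite -[X in measurable X]setTI; exact: measurable_coord_rV.
have -> : lebesgue_rV n.+1 [set v | forall i, A i (v ord0 i)] =
    (lebesgue_measure \x lebesgue_rV n)%E (A ord0 `*` B).
  rewrite /= /lebesgue_cons /pushforward.
  congr (product_measure1 _ _ _); apply/seteqP; split.
    move=> [x v] /= Axv; split => [|i].
      by have := Axv ord0; rewrite mxE unlift_none.
    by have := Axv (lift ord0 i); rewrite mxE liftK.
  by move=> [x v] [/= Ax Av] i; rewrite mxE; case: unliftP => [j ->|->].
by rewrite big_ord_recl -IH// product_measure1E//; exact: (mA ord0).
Qed.

End lebesgue_rV.

Section markov_chain.
Variables (R : realType) (H : finType) (varpi : H -> H -> R).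

Definition stochastic :=
  (forall h h', 0 <= varpi h h') /\ (forall h, \sum_h' varpi h h' = 1).

Fixpoint nstep (k : nat) (h h' : H) : R :=
  match k with
  | 0 => (h == h')%:R
  | k'.+1 => \sum_l varpi h l * nstep k' l h'
  end.

Definition irreducible_chain := forall h h', exists k, 0 < nstep k h h'.

(* The greatest common divisor of the return times of every state is 1. *)
Definition aperiodic_chain := forall h (g : nat),
  (forall k, (0 < k)%N -> 0 < nstep k h h -> (g %| k)%N) -> g = 1%N.

Definition stationary (nu : H -> R) :=
  [/\ forall h, 0 <= nu h, \sum_h nu h = 1 &
      forall h', \sum_h nu h * varpi h h' = nu h'].

End markov_chain.

Section conditioning.
Variables (R : realType) (disp : measure_display) (Omega : measurableType disp).
Variable P : probability Omega R.

Definition cprob (A C : set Omega) : R := fine (P (A `&` C)) / fine (P C).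

(* The systems F and G are independent conditionally on the event C. *)
Definition cond_indep (F G : set_system Omega) (C : set Omega) :=
  (0 < P C)%E -> forall A B, F A -> G B ->
  cprob (A `&` B) C = cprob A C * cprob B C.

Definition gen (T : Type) (S : set_system T) (X : Omega -> T) :
  set_system Omega := preimage_set_system setT X S.

(* sigma(X_0, ..., X_{t-1}) *)
Definition gen_before (T : Type) (S : set_system T) (X : nat -> Omega -> T)
  (t : nat) : set_system Omega := <<s \bigcup_(i in `I_t) gen S (X i) >>.

End conditioning.

Definition is_density (R : realType) n (D : set 'rV[R]_n) (g : 'rV[R]_n -> R) :=
  [/\ measurable_fun D g, forall x, D x -> 0 <= g x &
      (\int[lebesgue_rV R n]_(x in D) (g x)%:E = 1)%E].

Section data.
Variables (R : realType) (H : finType) (d : nat) (Xi : set 'rV[R]_d).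
Variables (varpi : H -> H -> R) (q : 'rV[R]_d -> H -> R).

(* Time is shifted: index t : nat stands for period t + 1, so the first *)
(* observation is (xi 0, eta 0).                                        *)
Record data_process (disp : measure_display) (Omega : measurableType disp)
    (P : probability Omega R) (eta1 : H)
    (xi : nat -> Omega -> 'rV[R]_d) (eta : nat -> Omega -> H) : Prop := {
  measurable_xi : forall t, measurable_fun setT (xi t) ;
  measurable_eta : forall t h, measurable (eta t @^-1` [set h]) ;
  xi_in_Xi : forall t w, Xi (xi t w) ;
  eta_init : forall w, eta 0 w = eta1 ;
  eta_transition : forall t h h', (0 < P (eta t @^-1` [set h]))%E ->
    cprob P (eta t.+1 @^-1` [set h']) (eta t @^-1` [set h]) = varpi h h' ;
  eta_markov : forall t (hs : nat -> H) h',
    let path := [set w | forall i, (i <= t)%N -> eta i w = hs i] in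
    (0 < P path)%E ->
    cprob P (eta t.+1 @^-1` [set h']) path =
    cprob P (eta t.+1 @^-1` [set h']) (eta t @^-1` [set hs t]) ;
  xi_density : forall t h A, measurable A -> (0 < P (eta t @^-1` [set h]))%E ->
    cprob P (xi t @^-1` A) (eta t @^-1` [set h]) =
    \int[lebesgue_rV R d]_(x in A `&` Xi) q x h ;
  xi_indep_past : forall t h,
    cond_indep P (gen measurable (xi t))
      <<s gen_before measurable xi t `|` gen_before setT eta t >>
      (eta t @^-1` [set h]) ;
  eta_next_indep : forall t h,
    cond_indep P (gen setT (eta t.+1)) (gen_before measurable xi t.+1)
      (eta t @^-1` [set h]) ;
  xi_indep_path : forall N i (hs : nat -> H), (i < N)%N ->
    cond_indep P (gen measurable (xi i)) (gen_before measurable xi i)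
      [set w | forall j, (j < N)%N -> eta j w = hs j]
}.

(* g is integrable with respect to dP*(x, h) = nu(h) q(x|h) dx. *)
Definition Pstar_integrable (nu : H -> R) (g : 'rV[R]_d -> H -> R) :=
  (forall h, measurable_fun Xi (g^~ h)) /\
  (\sum_h (nu h)%:E *
     \int[lebesgue_rV R d]_(x in Xi) (`|g x h| * q x h)%:E < +oo)%E.

End data.

Section posterior.
Variables (R : realType) (H : finType) (d s : nat).
Variables (Xi : set 'rV[R]_d) (Theta : set 'rV[R]_s) (varpi : H -> H -> R).
Variables (f : 'rV[R]_d -> H -> 'rV[R]_s -> R) (p : 'rV[R]_s -> R).
Variables (N : nat) (xs : nat -> 'rV[R]_d) (hs : nat -> H).

Definition likelihood (theta : 'rV[R]_s) : R :=
  f (xs 0) (hs 0) theta *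
  \prod_(1 <= i < N) (f (xs i) (hs i) theta * varpi (hs i.-1) (hs i)).

Definition posterior (theta : 'rV[R]_s) : R :=
  likelihood theta * p theta /
  \int[lebesgue_rV R s]_(t in Theta) (likelihood t * p t).

Definition posterior_expect (h : H) (Y : 'rV[R]_d -> R) : R :=
  \int[lebesgue_rV R s]_(theta in Theta)
    (\int[lebesgue_rV R d]_(x in Xi) (Y x * f x h theta * posterior theta)).

End posterior.

Definition true_expect (R : realType) (H : finType) d (Xi : set 'rV[R]_d)
    (q : 'rV[R]_d -> H -> R) (h : H) (Y : 'rV[R]_d -> R) : R :=
  \int[lebesgue_rV R d]_(x in Xi) (Y x * q x h).

Section bellman.
Variables (R : realType) (H : finType) (n m d : nat) (gamma : R).
Variables (X : set 'rV[R]_n) (U : set 'rV[R]_m) (Xi : set 'rV[R]_d).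
Variables (varpi : H -> H -> R).
Variables (c : 'rV[R]_n -> 'rV[R]_m -> 'rV[R]_d -> R).
Variables (F : 'rV[R]_n -> 'rV[R]_m -> 'rV[R]_d -> 'rV[R]_n).
Variable E : H -> ('rV[R]_d -> R) -> R.

Definition cost_to_go (V : 'rV[R]_n -> H -> R) x u h (xi : 'rV[R]_d) : R :=
  c x u xi + gamma * \sum_h' varpi h h' * V (F x u xi) h'.

(* The measurability clause is what gives the expectations in the equation *)
(* a meaning; no measurability of V itself is imposed.                     *)
Definition bellman_solution (V : 'rV[R]_n -> H -> R) :=
  [/\ exists M, forall x h, X x -> `|V x h| <= M,
      forall x u h, X x -> U u -> measurable_fun Xi (cost_to_go V x u h) &
      forall x h, X x -> V x h = inf [set E h (cost_to_go V x u h) | u in U]].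

Definition unique_bellman_solution (V : 'rV[R]_n -> H -> R) :=
  bellman_solution V /\
  forall W, bellman_solution W -> forall x h, X x -> W x h = V x h.

End bellman.

(* sup-distance on X x H; V and W are meant to be bounded there, so that the *)
(* real supremum is the genuine one.                                         *)
Definition sup_dist (R : realType) (H : finType) n (X : set 'rV[R]_n)
    (V W : 'rV[R]_n -> H -> R) : R :=
  sup [set `|V z.1 z.2 - W z.1 z.2| | z in X `*` [set: H]].

(* Main.v *)
Require Import Defs.
From mathcomp Require Import all_boot all_order all_algebra.
From mathcomp Require Import all_classical all_reals all_analysis.
From mathcomp Require Import measurable_realfun ring lra.
Set Implicit Arguments.
Unset Strict Implicit.
Unset Printing Implicit Defensive.
Import Order.TTheory GRing.Theory Num.Theory.
Import numFieldNormedType.Exports.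
Local Open Scope classical_set_scope.
Local Open Scope ring_scope.

(** The Bayesian Bellman operator differs from the true one only by the law of the
next observation, and both are contractions of ratio [gamma].  Hence the distance
between the value functions is at most [1 / (1 - gamma)] times the error made by
posterior predictive expectations on the bounded integrands built from the true
value function ([sup_dist_bellman_le]).  That error is at most a constant times
the posterior mean of the L1 distance between the densities at [theta] and at
the true parameter, so it is enough that the posterior concentrates, almost
surely, on the parameters whose densities are close to the true ones
([posterior_expect_bound]).

For the concentration, likelihood ratios with respect to the true parameter are
compared with exponentials in the sample size [N].

Far parameters.  If the densities at [t1] differ from the true ones in some state
[h0], the square root of the likelihood ratio is a product whose factors have
conditional expectation at most 1 given the past, and a Hellinger affinity
smaller than 1 when the chain visits [h0].  Irreducibility of the chain yields a
positive frequency of visits (through the Lyapunov function of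
[lyapunov_function]), so the likelihood ratio at [t1] decays exponentially
([ae_log_likelihood_ratio_decay]).

Neighbourhoods.  The decay at [t1] extends to a neighbourhood because the
oscillation of the log-densities is dominated by an integrable function and tends
to 0, so it has a small mean near [t1]; its empirical averages are then small by
a one-sided law of large numbers ([ae_eventually_sum_le],
[ae_local_uniform_law]).  Compactness of the parameter set makes this uniform
([ae_uniform_log_ratio_decay]), and the same local estimate at the true parameter
bounds the evidence from below by a slower exponential ([ae_log_ratio_ge]).

The probabilistic engine is a single inequality: products of nonnegative
functions of the successive observations, each of conditional mean at most 1,
have expectation at most 1 ([expectation_prod_le1]).  Exponentials of truncated
centred sums give the law of large numbers, square roots of density ratios give
the decay.  An L1 version of continuity, Scheffe's lemma ([L1_dist_small]),
provides both the measurability of predictive expectations in the parameter and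
the openness needed for compactness. *)

(** * Integrability and transfer of weighted integrals *)

Lemma bounded_mul_integrable (R : realType) d (T : measurableType d)
    (mu : {measure set T -> \bar R}) (D : set T) (b a : T -> R) (C : R) :
  measurable D -> measurable_fun D b -> (forall x, D x -> `|b x| <= C) ->
  mu.-integrable D (fun x => (a x)%:E) ->
  mu.-integrable D (fun x => (b x * a x)%:E).
Proof.
move=> mD mb bC ia.
have ma : measurable_fun D a by apply/measurable_EFinP; exact: measurable_int ia.
apply: (@le_integrable _ _ _ _ _ mD _ (fun x => (C * a x)%:E)).
- by apply/measurable_EFinP; exact: measurable_funM.
- move=> x Dx; rewrite !abse_EFin lee_fin !normrM ler_wpM2r//.
  by rewrite (le_trans (bC _ Dx))// ler_norm.
- by under eq_fun do rewrite EFinM; exact: integrableZl.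
Qed.

Lemma is_density_integrable (R : realType) n (D : set 'rV[R]_n) g :
  is_density D g -> (lebesgue_rV R n).-integrable D (fun x => (g x)%:E).
Proof.
move=> [mg g0 g1]; apply/integrableP; split; first exact/measurable_EFinP.
rewrite (eq_integral (fun x => (g x)%:E)) ?g1 ?ltry// => x /[!inE] Dx.
by rewrite gee0_abs// lee_fin g0.
Qed.

Section transfer.
Context (R : realType) d (T : measurableType d).
Import HBNNSimple.

Lemma integral_weighted_nnsfun d1 (T1 : measurableType d1)
    (mu : {measure set T1 -> \bar R}) (D : set T1) (X : T1 -> T) (a : T1 -> R)
    (mD : measurable D) (mX : measurable_fun D X) (ma : measurable_fun D a)
    (a0 : forall x, D x -> 0 <= a x) (h : {nnsfun T >-> R}) :
  (\int[mu]_(x in D) (h (X x) * a x)%:E =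
   \sum_(y \in range h) y%:E *
     \int[mu]_(x in D) (\1_(h @^-1` [set y]) (X x) * a x)%:E)%E.
Proof.
have m1 y : measurable_fun D (fun x => \1_(h @^-1` [set y]) (X x) : R).
  have mi : measurable_fun setT (\1_(h @^-1` [set y]) : T -> R) by [].
  exact: (measurableT_comp mi mX).
transitivity (\int[mu]_(x in D) (\sum_(y \in range h)
    (y * (\1_(h @^-1` [set y]) (X x) * a x))%:E))%E.
  apply: eq_integral => x _; rewrite fsumEFin //; congr EFin.
  rewrite [in LHS](fimfunE h) mulrC; under [RHS]eq_fsbigr do rewrite mulrA mulrC.
  by rewrite !fsbig_finite//= mulr_sumr.
rewrite ge0_integral_fsum //.
- apply: eq_fsbigr => y yr; under eq_integral do rewrite EFinM.
  rewrite ge0_integralZl_EFin//.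
  + by move=> x Dx; rewrite lee_fin mulr_ge0// a0.
  + by apply/measurable_EFinP; exact: measurable_funM.
  + by move: yr; rewrite inE => -[z _ <-].
- move=> y; apply/measurable_EFinP; apply: measurable_funM => //.
  exact: measurable_funM.
- move=> y x Dx; rewrite mulrA EFinM mule_ge0 ?lee_fin ?a0//.
  exact: (nnfun_muleindic_ge0 h).
Qed.

Lemma integral_weighted_approx d1 (T1 : measurableType d1)
    (mu : {measure set T1 -> \bar R}) (D : set T1) (X : T1 -> T) (a : T1 -> R)
    (mD : measurable D) (mX : measurable_fun D X) (ma : measurable_fun D a)
    (a0 : forall x, D x -> 0 <= a x)
    (f : T -> \bar R) (mf : measurable_fun setT f) (f0 : forall x, (0 <= f x)%E) :
  (\int[mu]_(x in D) (f (X x) * (a x)%:E) =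
   limn (fun n => \int[mu]_(x in D)
     (nnsfun_approx measurableT mf n (X x) * a x)%:E))%E.
Proof.
rewrite -monotone_convergence //.
- apply: eq_integral => x; rewrite inE => Dx; apply/esym/cvg_lim => //.
  under eq_fun do rewrite EFinM.
  by apply: cvgeZr => //; exact: cvg_nnsfun_approx.
- move=> n; apply/measurable_EFinP; apply: measurable_funM => //.
  exact: measurableT_comp.
- by move=> n x Dx; rewrite lee_fin mulr_ge0// a0.
- move=> x Dx m n mn; rewrite lee_fin ler_wpM2r ?a0//.
  exact/lefP/nd_nnsfun_approx.
Qed.

(** Two functionals of the form [f |-> \int f (X x) * a x], possibly living on
different measure spaces, coincide on all nonnegative measurable functions as
soon as they coincide on indicators.  Conditional laws and conditional
independence are given on events only; this is what turns them into statements
about integrals. *)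
Lemma integral_weighted_transfer
    d1 (T1 : measurableType d1) d2 (T2 : measurableType d2)
    (mu1 : {measure set T1 -> \bar R}) (mu2 : {measure set T2 -> \bar R})
    (D1 : set T1) (D2 : set T2) (X1 : T1 -> T) (X2 : T2 -> T)
    (a1 : T1 -> R) (a2 : T2 -> R)
    (mD1 : measurable D1) (mD2 : measurable D2)
    (mX1 : measurable_fun D1 X1) (mX2 : measurable_fun D2 X2)
    (ma1 : measurable_fun D1 a1) (ma2 : measurable_fun D2 a2)
    (a10 : forall x, D1 x -> 0 <= a1 x) (a20 : forall x, D2 x -> 0 <= a2 x)
    (same_indic : forall A, measurable A ->
      (\int[mu1]_(x in D1) (\1_A (X1 x) * a1 x)%:E =
       \int[mu2]_(x in D2) (\1_A (X2 x) * a2 x)%:E)%E)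
    (f : T -> \bar R) (mf : measurable_fun setT f) (f0 : forall x, (0 <= f x)%E) :
  (\int[mu1]_(x in D1) (f (X1 x) * (a1 x)%:E) =
   \int[mu2]_(x in D2) (f (X2 x) * (a2 x)%:E))%E.
Proof.
rewrite !integral_weighted_approx//; congr (limn _); apply/funext => n.
rewrite !integral_weighted_nnsfun//; apply: eq_fsbigr => y _.
by rewrite same_indic.
Qed.

End transfer.

(** * One observation given the past *)

Lemma closed_measurable_rV (R : realType) n (A : set 'rV[R]_n) :
  closed A -> measurable A.
Proof.
move=> cA; rewrite -[A]setCK; apply: measurableC.
by apply: sub_sigma_algebra; exact: closed_openC.
Qed.

Lemma open_measurable_rV (R : realType) n (A : set 'rV[R]_n) :
  open A -> measurable A.
Proof. by move=> oA; apply: sub_sigma_algebra. Qed.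

Lemma measurable_observable (R : realType) (H : finType) d (Xi : set 'rV[R]_d)
    disp (T : measurableType disp) (x : T -> 'rV[R]_d) (e : T -> H)
    (phi : 'rV[R]_d -> H -> R) :
  measurable Xi -> measurable_fun setT x -> (forall w, Xi (x w)) ->
  (forall h, measurable (e @^-1` [set h])) ->
  (forall h, measurable_fun Xi (phi^~ h)) ->
  measurable_fun setT (fun w => phi (x w) (e w)).
Proof.
move=> mXi mx Xix me mphi.
rewrite (_ : (fun w => _) =
  (fun w => \sum_h (\1_(e @^-1` [set h]) w * phi (x w) h))).
  apply: measurable_sum => h; apply: measurable_funM => //.
  apply: (measurable_comp mXi _ (mphi h) mx) => _ [w _ <-]; exact: Xix.
apply/funext => w; rewrite (bigD1 (e w))//= indicE mem_set//= mul1r.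
rewrite big1 ?addr0// => h hne; rewrite indicE memNset ?mul0r//= => ehw.
by rewrite ehw eqxx in hne.
Qed.

Section observations.
Context (R : realType) (H : finType) (d : nat) (Xi : set 'rV[R]_d).
Context (varpi : H -> H -> R) (q : 'rV[R]_d -> H -> R).
Context (disp : measure_display) (Omega : measurableType disp).
Context (P : probability Omega R) (eta1 : H).
Context (xi : nat -> Omega -> 'rV[R]_d) (eta : nat -> Omega -> H).
Context (Xi_closed : closed Xi) (q_density : forall h, is_density Xi (q^~ h)).
Context (data : data_process Xi varpi q P eta1 xi eta).

Let mXi : measurable Xi := closed_measurable_rV Xi_closed.

(** The generators of the information available just before the [t]-th
observation, apart from the current state. *)
Definition past t : set_system Omega :=
  gen_before measurable xi t `|` gen_before setT eta t.

Lemma past_measurable t B : <<s past t >> B -> measurable B.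
Proof.
apply: smallest_sub; first exact: sigma_algebra_measurable.
have gb (S : Type) (M : set_system S) (Y : nat -> Omega -> S) :
    (forall i B, gen M (Y i) B -> measurable B) ->
    gen_before M Y t `<=` @measurable _ Omega.
  move=> h; apply: smallest_sub; first exact: sigma_algebra_measurable.
  by move=> C [i _]; exact: h.
rewrite subUset; split; apply: gb => i C [A mA <-]; rewrite setTI.
  by rewrite -[X in measurable X]setTI; exact: (measurable_xi data i).
rewrite (_ : _ @^-1` _ = \big[setU/set0]_(h <- enum H | h \in A) (eta i @^-1` [set h])).
  by apply: bigsetU_measurable => h _; exact: (measurable_eta data).
apply/seteqP; split => w /=.
  by move=> Aw; rewrite -bigcup_seq_cond; exists (eta i w) => //=; rewrite mem_enum mem_set.
by rewrite -bigcup_seq_cond => -[h /= /andP[_ /set_mem Ah] ->].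
Qed.

Lemma past_xi t i : (i < t)%N ->
  measurable_fun setT (xi i : g_sigma_algebraType (past t) -> 'rV[R]_d).
Proof.
move=> it _ A mA; rewrite setTI; apply: sub_sigma_algebra; left.
by apply: sub_sigma_algebra; exists i => //; exists A => //; rewrite setTI.
Qed.

Lemma past_eta t i h : (i < t)%N ->
  measurable (eta i @^-1` [set h] : set (g_sigma_algebraType (past t))).
Proof.
move=> it; apply: sub_sigma_algebra; right.
by apply: sub_sigma_algebra; exists i => //; exists [set h] => //; rewrite setTI.
Qed.

Lemma prob_fin_num (A : set Omega) : measurable A -> P A \is a fin_num.
Proof. by move=> mA; exact: fin_num_measure. Qed.

(** Given the current state, the observation is independent of the past and has
density [q]; the product form also covers states of probability 0. *)
Lemma observation_law t h A B : measurable A -> <<s past t >> B ->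
  (P (eta t @^-1` [set h] `&` B `&` xi t @^-1` A) =
   P (eta t @^-1` [set h] `&` B) *
   \int[lebesgue_rV R d]_(x in A `&` Xi) (q x h)%:E)%E.
Proof.
move=> mA GB; set E := eta t @^-1` [set h].
have mE : measurable E by exact: (measurable_eta data).
have mB := past_measurable GB.
have mxA : measurable (xi t @^-1` A).
  by rewrite -[X in measurable X]setTI; exact: (measurable_xi data t).
have [PE0|PE0] := eqVneq (P E) 0%E.
  by rewrite !(subset_measure0 _ _ _ PE0) ?mul0e//;
    do ?[do ?apply: measurableI => //]; by [move=> w [[]]|move=> w []].
have {}PE0 : (0 < P E)%E by rewrite lt0e PE0 measure_ge0.
have fE : 0 < fine (P E) by rewrite fine_gt0// PE0 ltey_eq prob_fin_num.
have gA : gen measurable (xi t) (xi t @^-1` A).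
  by exists A => //; rewrite setTI.
have := xi_indep_past data PE0 gA GB; rewrite -/E (xi_density data)// /cprob.
have fq : (\int[lebesgue_rV R d]_(x in A `&` Xi) (q x h)%:E)%E \is a fin_num.
  apply: integrable_fin_num; first exact: measurableI.
  by apply: integrableS (is_density_integrable (q_density h)) => //; exact: measurableI.
move=> eqn; apply/eqP; rewrite -(fineK fq).
rewrite -(fineK (prob_fin_num (measurableI _ _ (measurableI _ _ mE mB) mxA))).
rewrite -(fineK (prob_fin_num (measurableI _ _ mE mB))) -EFinM eqe.
have sw : xi t @^-1` A `&` B `&` E = E `&` B `&` xi t @^-1` A.
  by rewrite setIC setIA setIAC.
move: eqn; rewrite sw (setIC B E) /Rintegral => eqn; apply/eqP.
apply: (mulIf (invr_neq0 (lt0r_neq0 fE))).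
by rewrite eqn mulrCA mulrA; congr (_ * _).
Qed.

(** The identity [E (Z * phi xi_t | eta_t = h) = E (Z | eta_t = h) * K] for [Z]
known before time [t].  It follows from [observation_law] by extending twice
from indicators: first in the observation, then in the past. *)
Lemma one_step t h (phi : 'rV[R]_d -> R) (K : R)
    (Z : g_sigma_algebraType (past t) -> \bar R) :
  measurable_fun Xi phi -> (forall x, Xi x -> 0 <= phi x) ->
  (\int[lebesgue_rV R d]_(x in Xi) (phi x * q x h)%:E = K%:E)%E ->
  measurable_fun setT Z -> (forall w, (0 <= Z w)%E) ->
  (\int[P]_(w in eta t @^-1` [set h]) (Z w * (phi (xi t w))%:E) =
   \int[P]_(w in eta t @^-1` [set h]) (Z w * K%:E))%E.
Proof.
move=> mphi phi0 Kphi mZ Z0; set E := eta t @^-1` [set h].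
have [mq q0 q1] := q_density h.
have mE : measurable E by exact: (measurable_eta data).
have K0 : 0 <= K.
  rewrite -lee_fin -Kphi; apply: integral_ge0 => x Xx.
  by rewrite lee_fin mulr_ge0// ?phi0// q0.
have mphixi D : measurable_fun D (fun w => phi (xi t w)).
  apply: measurable_funTS; apply: (measurable_comp mXi _ mphi (measurable_xi data t)).
  by move=> _ [w _ <-]; exact: (xi_in_Xi data).
apply: (@integral_weighted_transfer R _ (g_sigma_algebraType (past t)) _ Omega
  _ Omega P P E E id id (fun w => phi (xi t w)) (cst K)) => //.
- move=> _ B mB; apply: measurableI => //; exact: (past_measurable mB).
- move=> _ B mB; apply: measurableI => //; exact: (past_measurable mB).
- by move=> w _; apply: phi0; exact: (xi_in_Xi data).
(* It remains to treat the indicator of a past event [B]. *)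
move=> B mB /=; have mB' := past_measurable mB.
have mEB : measurable (E `&` B) by exact: measurableI.
transitivity (\int[P]_(w in E `&` B) ((phi \_ Xi) (xi t w))%:E)%E.
  rewrite [RHS]integral_mkcondr; apply: eq_integral => w _.
  rewrite /= indicE !patchE [xi t w \in Xi]mem_set; last exact: (xi_in_Xi data).
  by case: ifPn; rewrite ?mul1r ?mul0r.
pose p := fine (P (E `&` B)).
have pE : p%:E = P (E `&` B) by rewrite fineK ?prob_fin_num.
have p0 : 0 <= p by rewrite -lee_fin pE.
transitivity (\int[lebesgue_rV R d]_(x in Xi) ((phi \_ Xi) x * (p * q x h))%:E)%E.
  transitivity (\int[P]_(w in E `&` B)
      (((phi \_ Xi) (xi t w))%:E * (cst 1 w)%:E))%E.
    by apply: eq_integral => w _; rewrite /= mule1.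
  apply: (@integral_weighted_transfer R _ 'rV[R]_d _ Omega _ 'rV[R]_d P
    (lebesgue_rV R d) (E `&` B) Xi (xi t) id (cst 1) (fun x => p * q x h) mEB
    mXi _ _ _ _ _ _ _ (EFin \o (phi \_ Xi))) => //.
  - by apply: measurable_funTS; exact: (measurable_xi data).
  - exact: measurable_funM.
  - by move=> x Xx; rewrite mulr_ge0// q0.
  - move=> A mA.
    transitivity (P (E `&` B `&` xi t @^-1` A)).
      rewrite (setIC (E `&` B)) -integral_indic//; last first.
        by rewrite -[X in measurable X]setTI; exact: (measurable_xi data t).
      by apply: eq_integral => w _; rewrite /= mulr1.
    rewrite observation_law// -pE.
    transitivity (\int[lebesgue_rV R d]_(x in A `&` Xi) (p%:E * (q x h)%:E))%E.
      rewrite ge0_integralZl_EFin//; first exact: measurableI.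
      + by move=> x [_ Xx]; rewrite lee_fin q0.
      + by apply/measurable_EFinP; apply: measurable_funS mq => //; exact: subIsetr.
    rewrite setIC [LHS]integral_mkcondr; apply: eq_integral => x _.
    by rewrite patchE indicE; case: ifPn; rewrite ?mul1r ?mul0r.
  - apply/measurable_EFinP/measurable_restrict => //.
    by rewrite setTI.
  - move=> x; rewrite lee_fin /= patchE; case: ifPn => // /set_mem; exact: phi0.
transitivity (p%:E * K%:E)%E.
  rewrite -Kphi -ge0_integralZl_EFin//.
  - apply: eq_integral => x xX; rewrite patchE xX /= -EFinM; congr EFin; ring.
  - by move=> x Xx; rewrite lee_fin mulr_ge0 ?phi0 ?q0.
  - by apply/measurable_EFinP; exact: measurable_funM.
rewrite pE -integral_indic//.
rewrite -[RHS]/(\int[P]_(w in E) (\1_B w * K)%:E)%E.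
under [RHS]eq_integral do rewrite EFinM.
rewrite ge0_integralZr//; last first.
  by apply/measurable_EFinP; exact: measurable_indic.
by congr (_ * _)%E; rewrite integral_indic// integral_indic// setIC.
Qed.
End observations.

(** * Expectations along the observed process *)

Lemma integral_by_value (R : realType) d (T : measurableType d)
    (mu : {measure set T -> \bar R}) (I : finType) (e : T -> I)
    (Y : T -> \bar R) :
  (forall i, measurable (e @^-1` [set i])) ->
  measurable_fun setT Y -> (forall w, 0 <= Y w)%E ->
  (\int[mu]_w Y w = \sum_i \int[mu]_(w in e @^-1` [set i]) Y w)%E.
Proof.
move=> me mY Y0.
rewrite -[RHS]big_enum /= -ge0_integral_bigsetU //=.
- congr (integral _ _ _); apply/seteqP; split => // w _.
  by rewrite -bigcup_seq; exists (e w) => //=; rewrite mem_enum.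
- by rewrite enum_uniq.
- by move=> h h' _ _ [w [/= -> ->]].
- exact: measurable_funTS.
Qed.

Lemma nstep_ge0 (R : realType) (H : finType) (varpi : H -> H -> R) k h h' :
  stochastic varpi -> 0 <= nstep varpi k h h'.
Proof.
move=> [v0 _]; elim: k h => [|k IH] h /=; first exact: ler0n.
by apply: sumr_ge0 => l _; rewrite mulr_ge0.
Qed.

Section expectations.
Context (R : realType) (H : finType) (d : nat) (Xi : set 'rV[R]_d).
Context (varpi : H -> H -> R) (q : 'rV[R]_d -> H -> R).
Context (disp : measure_display) (Omega : measurableType disp).
Context (P : probability Omega R) (eta1 : H).
Context (xi : nat -> Omega -> 'rV[R]_d) (eta : nat -> Omega -> H).
Context (Xi_closed : closed Xi) (q_density : forall h, is_density Xi (q^~ h)).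
Context (data : data_process Xi varpi q P eta1 xi eta).

Let mXi : measurable Xi := closed_measurable_rV Xi_closed.

Lemma measurable_obs (phi : 'rV[R]_d -> H -> R) t :
  (forall h, measurable_fun Xi (phi^~ h)) ->
  measurable_fun setT (fun w => phi (xi t w) (eta t w)).
Proof.
move=> mphi; apply: (measurable_observable mXi) => //.
- exact: (measurable_xi data).
- exact: (xi_in_Xi data).
- exact: (measurable_eta data).
Qed.

(** The products form a nonnegative supermartingale: given the past, each new
factor has conditional expectation at most 1.  The almost sure estimates on the
observations come from this inequality, applied to well chosen factors. *)
Lemma expectation_prod_le1 (phi : 'rV[R]_d -> H -> R) :
  (forall h, measurable_fun Xi (phi^~ h)) ->
  (forall x h, Xi x -> 0 <= phi x h) ->
  (forall h, \int[lebesgue_rV R d]_(x in Xi) (phi x h * q x h)%:E <= 1)%E ->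
  forall N, (\int[P]_w (\prod_(i < N) phi (xi i w) (eta i w))%:E <= 1)%E.
Proof.
move=> mphi phi0 phi1; elim=> [|N IH].
  under eq_integral do rewrite big_ord0.
  by rewrite integral_cst// mul1e probability_le1.
have mprod n : measurable_fun setT
    (fun w => (\prod_(i < n) phi (xi i w) (eta i w))%:E).
  by apply/measurable_EFinP/measurable_prod => i _; exact: measurable_obs.
have prod0 n w : (0 <= (\prod_(i < n) phi (xi i w) (eta i w))%:E)%E.
  by rewrite lee_fin prodr_ge0// => i _; apply: phi0; exact: (xi_in_Xi data).
apply: le_trans IH.
rewrite (integral_by_value P (measurable_eta data N) (mprod _) (prod0 _)).
rewrite (integral_by_value P (measurable_eta data N) (mprod _) (prod0 _)).
apply: lee_sum => h _.
have [_ q0 _] := q_density h.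
have pq0 x : Xi x -> (0 <= (phi x h * q x h)%:E)%E.
  by move=> Xx; rewrite lee_fin mulr_ge0// ?phi0// q0.
set I := (\int[lebesgue_rV R d]_(x in Xi) (phi x h * q x h)%:E)%E in phi1 *.
have I0 : (0 <= I)%E by exact: integral_ge0.
have If : I \is a fin_num.
  by rewrite ge0_fin_numE// (le_lt_trans (phi1 h)) ?ltry.
rewrite (eq_integral (fun w => (\prod_(i < N) phi (xi i w) (eta i w))%:E *
    (phi (xi N w) h)%:E)%E); last first.
  by move=> w; rewrite inE/= => <-; rewrite big_ord_recr EFinM.
rewrite (@one_step R H d Xi varpi q disp Omega P eta1 xi eta Xi_closed q_density
  data N h (phi^~ h) (fine I)
  (fun w => (\prod_(i < N) phi (xi i w) (eta i w))%:E)) ?fineK//.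
- apply: ge0_le_integral => //.
  + exact: (measurable_eta data).
  + by move=> w _; rewrite mule_ge0.
  + by apply: emeasurable_funM => //; exact: measurable_funTS.
  + exact: measurable_funTS.
  + by move=> w _; rewrite muleC gee_pMl ?prod0 ?phi1.
- by move=> x; exact: phi0.
- apply/measurable_EFinP/measurable_prod => i _.
  apply: (measurable_observable mXi) => //.
  + exact: past_xi.
  + exact: (xi_in_Xi data).
  + by move=> h'; exact: past_eta.
Qed.

Lemma expectation_obs_le (phi : 'rV[R]_d -> H -> R) (K : H -> R) t :
  (forall h, measurable_fun Xi (phi^~ h)) ->
  (forall x h, Xi x -> 0 <= phi x h) ->
  (forall h, \int[lebesgue_rV R d]_(x in Xi) (phi x h * q x h)%:E = (K h)%:E)%E ->
  (\int[P]_w (phi (xi t w) (eta t w))%:E <= (\sum_h K h)%:E)%E.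
Proof.
move=> mphi phi0 phiK.
rewrite (integral_by_value P (measurable_eta data t)); last 2 first.
- by apply/measurable_EFinP; exact: measurable_obs.
- by move=> w; rewrite lee_fin phi0//; exact: (xi_in_Xi data).
rewrite -sumEFin; apply: lee_sum => h _.
have [_ q0 _] := q_density h.
have mE := measurable_eta data t h.
rewrite (eq_integral (fun w => 1 * (phi (xi t w) h)%:E)%E); last first.
  by move=> w; rewrite inE/= => <-; rewrite mul1e.
rewrite (@one_step R H d Xi varpi q disp Omega P eta1 xi eta Xi_closed q_density
  data t h (phi^~ h) (K h) (cst 1%E))//; last by move=> x; exact: phi0.
have K0 : 0 <= K h.
  rewrite -lee_fin -phiK; apply: integral_ge0 => x Xx.
  by rewrite lee_fin mulr_ge0// ?phi0// q0.
under eq_integral do rewrite mul1e.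
by rewrite integral_cst//= muleC gee_pMl ?lee_fin ?fin_num_measure// probability_le1.
Qed.

End expectations.

(** A Borel-Cantelli argument for random variables: the series of the [X n] has
a finite expectation, hence converges almost surely, so its terms vanish. *)
Lemma ae_eventually_lt1 (R : realType) d (T : measurableType d)
    (mu : {measure set T -> \bar R}) (X : nat -> T -> R) (C : R) :
  (forall n, measurable_fun setT (X n)) -> (forall n w, 0 <= X n w) ->
  (forall n, (\sum_(k < n) \int[mu]_w (X k w)%:E <= C%:E)%E) ->
  {ae mu, forall w, \forall n \near \oo, X n w < 1}.
Proof.
move=> mX X0 XC.
have mX' n : measurable_fun setT (fun w => (X n w)%:E) by exact/measurable_EFinP.
have X0' n w : (0 <= (X n w)%:E)%E by rewrite lee_fin.
pose S w := (\sum_(k <oo) (X k w)%:E)%E.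
have mS : measurable_fun setT S.
  by apply: ge0_emeasurable_sum.
have S0 w : (0 <= S w)%E by apply: nneseries_ge0.
have IS : mu.-integrable setT S.
  apply/integrableP; split => //.
  under eq_integral do rewrite gee0_abs//.
  rewrite integral_nneseries//; apply: (@le_lt_trans _ _ C%:E); last exact: ltry.
  apply: lime_le.
    by apply: is_cvg_nneseries => n _ _; exact: integral_ge0.
  by apply: nearW => n; rewrite big_mkord.
apply: filterS (integrable_ae measurableT IS) => w /(_ I) Sf.
have : (X^~ w) @ \oo --> (0 : R).
  apply: cvg_series_cvg_0.
  apply: nondecreasing_is_cvgn.
    by apply: nondecreasing_series => n _ _; exact: X0.
  exists (fine (S w)) => _ [n _ <-].
  rewrite -lee_fin fineK// seriesEnat /= -sumEFin.
  exact: nneseries_lim_ge.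
by move=> /cvgr_lt; apply; exact: ltr01.
Qed.

(** * A one-sided law of large numbers *)

Lemma expR_le_quadratic (R : realType) (x : R) :
  x <= 2^-1 -> expR x <= 1 + x + 2 * x ^+ 2.
Proof.
move=> x2; have x1 : 0 < 1 - x by lra.
have : expR x <= (1 - x)^-1.
  by rewrite -[x]opprK expRN lef_pV2 ?posrE ?expR_gt0 ?opprK// expR_ge1Dx.
move=> /le_trans; apply; rewrite -div1r ler_pdivrMr//.
have : 0 <= x ^+ 2 * (1 - 2 * x) by rewrite mulr_ge0 ?sqr_ge0//; lra.
by rewrite !expr2; nra.
Qed.

Lemma expR_sub1_le (R : realType) (u : R) : expR u - 1 <= u * expR u.
Proof.
have e0 := expR_gt0 u.
have : expR u * expR (- u) = 1 by rewrite -expRD subrr expR0.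
have := expR_ge1Dx (- u); nra.
Qed.

Lemma sqr_le_cosh (R : realType) (x : R) :
  0 <= x -> x ^+ 2 / 4 <= expR x + expR (- x) - 2.
Proof.
move=> x0; pose a := expR (x / 2); pose b := expR (- (x / 2)).
have ab : a * b = 1 by rewrite /a /b -expRD subrr expR0.
have -> : expR x = a ^+ 2 by rewrite expr2 /a -expRD; congr expR; field.
have -> : expR (- x) = b ^+ 2 by rewrite expr2 /b -expRD; congr expR; field.
have a1 : 1 + x / 2 <= a by exact: expR_ge1Dx.
have b1 : b <= 1 by rewrite /b expR_le1; lra.
have : 0 <= (a - b - x / 2) by lra.
nra.
Qed.

Lemma cosh_ge2 (R : realType) (x : R) : 0 <= expR x + expR (- x) - 2.
Proof.
by have := expR_ge1Dx x; have := expR_ge1Dx (- x); lra.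
Qed.

(** The terms with [2 ^+ n <= w] grow geometrically and those with
[w <= 2 ^+ n] decay geometrically, so both parts of the sum are of the order of
[w].  This is why one moment suffices in the law of large numbers below. *)
Lemma sum_dyadic_truncation (R : realType) (w : R) k : 0 <= w ->
  \sum_(n < k) (Num.min w (2 ^+ n)) ^+ 2 / 2 ^+ n <= 4 * w.
Proof.
move=> w0.
have p0 n : 0 < (2 : R) ^+ n by rewrite exprn_gt0.
(* The second bound, whose correction term telescopes, is only available beyond
   the level where the truncation stops acting; the first one serves before. *)
suff [h1 h2] : \sum_(n < k) (Num.min w (2 ^+ n)) ^+ 2 / 2 ^+ n <= 2 ^+ k /\
    (w <= 2 ^+ k -> \sum_(n < k) (Num.min w (2 ^+ n)) ^+ 2 / 2 ^+ n <=
       4 * w - 2 * (w ^+ 2 / 2 ^+ k)).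
  have [/h2 h|h] := leP w (2 ^+ k); last by apply: (le_trans h1); lra.
  apply: (le_trans h); rewrite gerBl mulr_ge0// divr_ge0 ?sqr_ge0//.
elim: k => [|k [IH1 IH2]].
  rewrite big_ord0 expr0; split=> // w1; rewrite divr1 expr2; nra.
rewrite big_ord_recr /= ![2 ^+ k.+1]exprS.
move: (\sum_(_ < _) _) (2 ^+ k) (p0 k) IH1 IH2 => S a a0 IH1 IH2.
have [wa|aw] := leP w a.
  have T : w ^+ 2 / a <= a by rewrite ler_pdivrMr// expr2; nra.
  split; first by lra.
  move=> _; have := IH2 wa.
  have -> : w ^+ 2 / (2 * a) = w ^+ 2 / a / 2 by field; rewrite gt_eqF.
  by lra.
have -> : a ^+ 2 / a = a by field; rewrite gt_eqF.
split; first by lra.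
move=> w2; have : w ^+ 2 / (2 * a) <= w.
  by rewrite ler_pdivrMr ?mulr_gt0// expr2; nra.
by lra.
Qed.

Section exponential_moments.
Context (R : realType) (H : finType) (d : nat) (Xi : set 'rV[R]_d).
Context (varpi : H -> H -> R) (q : 'rV[R]_d -> H -> R).
Context (disp : measure_display) (Omega : measurableType disp).
Context (P : probability Omega R) (eta1 : H).
Context (xi : nat -> Omega -> 'rV[R]_d) (eta : nat -> Omega -> H).
Context (Xi_closed : closed Xi) (q_density : forall h, is_density Xi (q^~ h)).
Context (data : data_process Xi varpi q P eta1 xi eta).

Let mXi : measurable Xi := closed_measurable_rV Xi_closed.

Lemma bounded_mul_q_integrable (b : 'rV[R]_d -> R) (C : R) h :
  measurable_fun Xi b -> (forall x, Xi x -> `|b x| <= C) ->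
  (lebesgue_rV R d).-integrable Xi (fun x => (b x * q x h)%:E).
Proof.
move=> mb bC; apply: (bounded_mul_integrable mXi mb bC).
exact: is_density_integrable.
Qed.

Lemma integral_expR_le (b : 'rV[R]_d -> R) (C t : R) h :
  measurable_fun Xi b -> (forall x, Xi x -> `|b x| <= C) ->
  (forall x, Xi x -> t * b x <= 2^-1) ->
  (\int[lebesgue_rV R d]_(x in Xi) (expR (t * b x) * q x h)%:E <=
   (expR (t * \int[lebesgue_rV R d]_(x in Xi) (b x * q x h) +
     2 * t ^+ 2 * \int[lebesgue_rV R d]_(x in Xi) (b x ^+ 2 * q x h)))%:E)%E.
Proof.
move=> mb bC tb; have [mq q0 q1] := q_density h.
have mb2 : measurable_fun Xi (fun x => b x ^+ 2) by exact: measurable_funX.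
have I1 := bounded_mul_q_integrable h mb bC.
have I2 : (lebesgue_rV R d).-integrable Xi (fun x => (b x ^+ 2 * q x h)%:E).
  apply: (@bounded_mul_q_integrable _ (C ^+ 2)) => // x Xx.
  by rewrite normrX lerXn2r// ?nnegrE ?bC// (le_trans _ (bC _ Xx)).
have I0 := is_density_integrable (q_density h).
apply: (@le_trans _ _ (\int[lebesgue_rV R d]_(x in Xi)
   ((q x h)%:E + ((t * (b x * q x h))%:E +
      (2 * t ^+ 2 * (b x ^+ 2 * q x h))%:E)))%E).
  apply: ge0_le_integral => //.
  - by move=> x Xx; rewrite lee_fin mulr_ge0 ?expR_ge0 ?q0.
  - apply/measurable_EFinP; apply: measurable_funM => //.
    by apply: measurableT_comp => //; exact: measurable_funM.
  - apply: emeasurable_funD; first exact/measurable_EFinP.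
    by apply: emeasurable_funD; apply/measurable_EFinP;
      apply: measurable_funM => //; exact: measurable_funM.
  - move=> x Xx; rewrite -!EFinD lee_fin.
    have := expR_le_quadratic (tb _ Xx); have := q0 _ Xx.
    set e := expR _; rewrite exprMn => q0x e1.
    by have := ler_wpM2r q0x e1; lra.
have J1 : (lebesgue_rV R d).-integrable Xi (fun x => (t * (b x * q x h))%:E).
  by under eq_fun do rewrite EFinM; exact: integrableZl.
have J2 : (lebesgue_rV R d).-integrable Xi
    (fun x => (2 * t ^+ 2 * (b x ^+ 2 * q x h))%:E).
  by under eq_fun do rewrite EFinM; exact: integrableZl.
rewrite integralD//; last exact: integrableD.
rewrite integralD// q1.
rewrite -(fineK (integrable_fin_num mXi J1)) -(fineK (integrable_fin_num mXi J2)).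
rewrite -[fine _]/(\int[lebesgue_rV R d]_(x in Xi) (t * (b x * q x h))).
rewrite -[X in (_ + (_ + X%:E))%E]/(\int[lebesgue_rV R d]_(x in Xi)
  (2 * t ^+ 2 * (b x ^+ 2 * q x h))).
rewrite !RintegralZl// -!EFinD lee_fin; exact: expR_ge1Dx.
Qed.

(** The factors [expR (t * b - t * m - 2 * t ^+ 2 * V)], where [m] is the
conditional mean of [b], have conditional expectation at most 1, because
[expR y <= 1 + y + 2 * y ^+ 2] for [y <= 1/2]. *)
Lemma expectation_expR_deviation_le (b : 'rV[R]_d -> H -> R) (C t V : R) N :
  (forall h, measurable_fun Xi (b^~ h)) ->
  (forall x h, Xi x -> `|b x h| <= C) ->
  (forall x h, Xi x -> t * b x h <= 2^-1) ->
  (forall h, \int[lebesgue_rV R d]_(x in Xi) (b x h ^+ 2 * q x h) <= V) ->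
  (\int[P]_w (expR (t * \sum_(i < N) (b (xi i w) (eta i w) -
      \int[lebesgue_rV R d]_(x in Xi) (b x (eta i w) * q x (eta i w)))))%:E <=
   (expR (2 * t ^+ 2 * N%:R * V))%:E)%E.
Proof.
move=> mb bC tb bV.
pose m h := \int[lebesgue_rV R d]_(x in Xi) (b x h * q x h).
pose phi x h := expR (t * b x h) * expR (- (t * m h + 2 * t ^+ 2 * V)).
have phi0 x h : 0 <= phi x h by rewrite mulr_ge0// expR_ge0.
have mphi h : measurable_fun Xi (phi^~ h).
  apply: measurable_funM => //.
  by apply: measurableT_comp => //; exact: measurable_funM.
have phi1 h : (\int[lebesgue_rV R d]_(x in Xi) (phi x h * q x h)%:E <= 1)%E.
  have [mq q0 q1] := q_density h.
  rewrite (eq_integral (fun x => (expR (- (t * m h + 2 * t ^+ 2 * V)))%:E *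
     (expR (t * b x h) * q x h)%:E)%E); last first.
    by move=> x _; rewrite /phi -EFinM; congr EFin; ring.
  rewrite ge0_integralZl_EFin//.
  - set x := _ + _.
    apply: (@le_trans _ _ ((expR (- x))%:E * (expR x)%:E)%E); last first.
      by rewrite -EFinM -expRD addNr expR0.
    apply: lee_wpmul2l; first by rewrite lee_fin expR_ge0.
    apply: (le_trans (integral_expR_le h (mb h) (fun x => bC x h) (fun x => tb x h))).
    by rewrite lee_fin ler_expR lerD2l ler_wpM2l// mulr_ge0// sqr_ge0.
  - by move=> x Xx; rewrite lee_fin mulr_ge0 ?expR_ge0 ?q0.
  - apply/measurable_EFinP; apply: measurable_funM => //.
    by apply: measurableT_comp => //; exact: measurable_funM.
have E1 := expectation_prod_le1 Xi_closed q_density data mphi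
  (fun x h _ => phi0 x h) phi1 N.
have -> : 2 * t ^+ 2 * N%:R * V = \sum_(i < N) (2 * t ^+ 2 * V).
  by rewrite sumr_const card_ord -mulr_natr; ring.
rewrite (eq_integral (fun w => (expR (\sum_(i < N) (2 * t ^+ 2 * V)))%:E *
   (\prod_(i < N) phi (xi i w) (eta i w))%:E)%E); last first.
  move=> w _; rewrite -EFinM; congr EFin.
  have -> : \prod_(i < N) phi (xi i w) (eta i w) = expR (\sum_(i < N)
      (t * b (xi i w) (eta i w) - (t * m (eta i w) + 2 * t ^+ 2 * V))).
    by rewrite expR_sum; apply: eq_bigr => i _; rewrite expRD.
  rewrite -expRD mulr_sumr -big_split /=; congr expR.
  by apply: eq_bigr => i _; rewrite /m; ring.
rewrite ge0_integralZl_EFin//.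
- by rewrite -[leRHS]mule1 lee_wpmul2l// lee_fin expR_ge0.
- by move=> w _; rewrite lee_fin prodr_ge0.
- apply/measurable_EFinP/measurable_prod => i _.
  exact: (measurable_obs Xi_closed data).
Qed.
End exponential_moments.

Section law_of_large_numbers.
Context (R : realType) (H : finType) (d : nat) (Xi : set 'rV[R]_d).
Context (varpi : H -> H -> R) (q : 'rV[R]_d -> H -> R).
Context (disp : measure_display) (Omega : measurableType disp).
Context (P : probability Omega R) (eta1 : H).
Context (xi : nat -> Omega -> 'rV[R]_d) (eta : nat -> Omega -> H).
Context (Xi_closed : closed Xi) (q_density : forall h, is_density Xi (q^~ h)).
Context (data : data_process Xi varpi q P eta1 xi eta).

Let mXi : measurable Xi := closed_measurable_rV Xi_closed.

Context (W : 'rV[R]_d -> H -> R) (mu : R).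
Context (mW : forall h, measurable_fun Xi (W^~ h)).
Context (W0 : forall x h, Xi x -> 0 <= W x h) (mu0 : 0 < mu).
Context (Wmu : forall h,
  (\int[lebesgue_rV R d]_(x in Xi) (W x h * q x h)%:E <= mu%:E)%E).

(* In the block of length [2 ^ n] the summands are truncated at [2 ^+ n]. *)
Let Y n x h := Num.min (W x h) (2 ^+ n).
Let m n h := \int[lebesgue_rV R d]_(x in Xi) (Y n x h * q x h).
Let v n h := \int[lebesgue_rV R d]_(x in Xi) (Y n x h ^+ 2 * q x h).
(* Bounds, up to constants, the exceptional probabilities of block [n]. *)
Let u n := (\sum_h v n h) / 2 ^+ n.

Let p2 n : 0 < (2 : R) ^+ n. Proof. by rewrite exprn_gt0. Qed.

Let mY n h : measurable_fun Xi (fun x => Y n x h).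
Proof. by apply: measurable_minr => //. Qed.

Let Y0 n x h : Xi x -> 0 <= Y n x h.
Proof. by move=> Xx; rewrite le_min W0//= ltW. Qed.

Let Y2 n x h : Xi x -> `|Y n x h| <= 2 ^+ n.
Proof. by move=> Xx; rewrite ger0_norm ?Y0// ge_min lexx orbT. Qed.

Let q0 h x : Xi x -> 0 <= q x h. Proof. by case: (q_density h) => _ + _; exact. Qed.
Let mq h : measurable_fun Xi (q^~ h). Proof. by case: (q_density h). Qed.

Let iY n h : (lebesgue_rV R d).-integrable Xi (fun x => (Y n x h * q x h)%:E).
Proof.
exact: (bounded_mul_q_integrable Xi_closed q_density _ (mY n h) (fun x => Y2 n h (x := x))).
Qed.

Let iY2 n h : (lebesgue_rV R d).-integrable Xi (fun x => (Y n x h ^+ 2 * q x h)%:E).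
Proof.
apply: (bounded_mul_q_integrable Xi_closed q_density (C := (2 ^+ n) ^+ 2)).
  exact: measurable_funX.
by move=> x Xx; rewrite normrX lerXn2r ?nnegrE ?Y2// ltW.
Qed.

Let m_le n h : m n h <= mu.
Proof.
rewrite -lee_fin /m /Rintegral fineK; last exact: integrable_fin_num.
apply: le_trans (Wmu h); apply: ge0_le_integral => //.
- by move=> x Xx; rewrite lee_fin mulr_ge0 ?Y0 ?q0.
- exact: measurable_int (iY n h).
- by apply/measurable_EFinP; exact: measurable_funM.
- by move=> x Xx; rewrite lee_fin ler_wpM2r ?q0// ge_min lexx.
Qed.

Let v0 n h : 0 <= v n h.
Proof. by apply: Rintegral_ge0 => x Xx; rewrite mulr_ge0 ?sqr_ge0 ?q0. Qed.

Let u0 n : 0 <= u n.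
Proof. by rewrite divr_ge0 ?sumr_ge0// ltW. Qed.

Let sum_u k : \sum_(n < k) u n <= 4 * mu *+ #|H|.
Proof.
rewrite /u; under eq_bigr do rewrite mulr_suml.
rewrite exchange_big /= -[leRHS]sumr_const; apply: ler_sum => h _.
rewrite -lee_fin; under eq_bigr do rewrite mulrC.
under eq_bigr do rewrite -(@RintegralZl _ _ _ _ _ _ _ mXi (iY2 _ h)).
rewrite -sumEFin.
have iZ n : (lebesgue_rV R d).-integrable Xi
    (fun x => ((2 ^+ n)^-1 * (Y n x h ^+ 2 * q x h))%:E).
  by under eq_fun do rewrite EFinM; exact: integrableZl.
under eq_bigr do rewrite /Rintegral fineK ?(integrable_fin_num mXi (iZ _))//.
rewrite -integral_sum//.
apply: (@le_trans _ _ (\int[lebesgue_rV R d]_(x in Xi) (4%:E * (W x h * q x h)%:E))%E).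
  apply: ge0_le_integral => //.
  - move=> x Xx; apply: sume_ge0 => n _; rewrite lee_fin.
    by rewrite mulr_ge0 ?invr_ge0 ?(ltW (p2 n))// mulr_ge0 ?sqr_ge0 ?q0.
  - by apply: emeasurable_sum => n; exact: measurable_int (iZ n).
  - by apply/measurable_EFinP; apply: measurable_funM => //; exact: measurable_funM.
  - move=> x Xx; rewrite sumEFin -EFinM lee_fin mulrA.
    apply: le_trans (ler_wpM2r (q0 h Xx) (sum_dyadic_truncation k (W0 h Xx))).
    by rewrite mulr_suml; apply: ler_sum => n _; rewrite /Y mulrA [_ * _ ^-1]mulrC.
rewrite ge0_integralZl_EFin//.
- by rewrite EFinM lee_wpmul2l.
- by move=> x Xx; rewrite lee_fin mulr_ge0 ?W0 ?q0.
- by apply/measurable_EFinP; exact: measurable_funM.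
Qed.

(* The largest exponent for which [t n * Y n] stays below 1/2. *)
Let t n : R := (2 ^+ n.+1)^-1.
Let S n w := \sum_(i < 2 ^ n) (Y n (xi i w) (eta i w) - m n (eta i w)).

Let mS n : measurable_fun setT (S n).
Proof.
apply: measurable_sum => i.
apply: (measurable_obs Xi_closed data (phi := fun x h => Y n x h - m n h)) => h.
exact: measurable_funB.
Qed.

Let tY n x h : Xi x -> `|t n * Y n x h| <= 2^-1.
Proof.
move=> Xx; rewrite normrM (ger0_norm (_ : 0 <= t n)); last first.
  by rewrite invr_ge0 ltW.
rewrite /t exprS invfM -mulrA ger_pMr ?invr_gt0//.
by rewrite ler_pdivrMl// mulr1 Y2.
Qed.

Let E_exp n s : s ^+ 2 = 1 ->
  (\int[P]_w (expR (s * t n * S n w))%:E <= (expR (u n / 2))%:E)%E.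
Proof.
move=> s2; have sn : `|s| = 1.
  by apply/eqP; rewrite -sqrp_eq1// ?real_normK ?num_real ?s2.
have -> : u n / 2 = 2 * (s * t n) ^+ 2 * (2 ^ n)%:R * (\sum_h v n h).
  rewrite exprMn s2 mul1r /u /t natrX [2 ^+ n.+1]exprS; have := p2 n.
  by move: (2 ^+ n) => a a0; field; rewrite gt_eqF.
apply: (expectation_expR_deviation_le Xi_closed q_density data (C := 2 ^+ n)) => //.
- by move=> x h; exact: Y2.
- move=> x h Xx; apply: (le_trans (ler_norm _)).
  by rewrite -mulrA normrM sn mul1r tY.
- by move=> h; rewrite (bigD1 h)//= lerDl sumr_ge0.
Qed.

(* [Z1 n w < 1] forces the centred block sum below [mu * 2 ^+ n], and
   [Z2 n w < 1] says that no truncation occurs in the block. *)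
Let Z1 n w := (expR (t n * S n w) + expR (- (t n * S n w)) - 2) * (16 / mu ^+ 2).
Let Z2 n w := \sum_(i < 2 ^ n) (Y n (xi i w) (eta i w) / 2 ^+ n) ^+ 2.

Let U := 4 * mu *+ #|H|.
Let u_le n : u n <= U.
Proof.
by apply: le_trans (sum_u n.+1); rewrite big_ord_recr /= lerDr sumr_ge0.
Qed.

Let E_Z1 n : (\int[P]_w (Z1 n w)%:E <= (u n * (expR U * (16 / mu ^+ 2)))%:E)%E.
Proof.
have c0 : 0 <= 16 / mu ^+ 2 by rewrite divr_ge0// sqr_ge0.
have me s : measurable_fun setT (fun w => (expR (s * t n * S n w))%:E).
  apply/measurable_EFinP/measurableT_comp => //.
  exact: measurable_funM.
rewrite (eq_integral (fun w => (16 / mu ^+ 2)%:E *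
  (expR (t n * S n w) + expR (- (t n * S n w)) - 2)%:E)%E); last first.
  by move=> w _; rewrite -EFinM /Z1 mulrC.
have mk : measurable_fun setT
    (fun w => (expR (t n * S n w) + expR (- (t n * S n w)) - 2)%:E).
  apply/measurable_EFinP/measurable_funB => //; apply: measurable_funD.
    by apply: measurableT_comp => //; exact: measurable_funM.
  by do 2!apply: measurableT_comp => //; exact: measurable_funM.
rewrite ge0_integralZl_EFin//; last by move=> w _; rewrite lee_fin cosh_ge2.
rewrite mulrA EFinM muleC lee_wpmul2r ?lee_fin//.
set J := (\int[P]_w _)%E.
have J2 : (J + 2%:E <= (expR (u n / 2))%:E + (expR (u n / 2))%:E)%E.
  apply: le_trans (leeD (E_exp n (expr1n _ 2)) (E_exp n (s := -1) _)); last first.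
    by rewrite sqrrN expr1n.
  rewrite -ge0_integralD//.
  have -> : 2%:E = (\int[P]_w (2%:E))%E.
    by rewrite integral_cst//= probability_setT mule1.
  rewrite -ge0_integralD//; last by move=> w _; rewrite lee_fin cosh_ge2.
  apply: ge0_le_integral => //.
  - by move=> w _; rewrite adde_ge0// lee_fin ?cosh_ge2.
  - exact: emeasurable_funD.
  - exact: emeasurable_funD.
  - by move=> w _; rewrite -!EFinD lee_fin mul1r mulN1r mulNr subrK.
have J0 : (0 <= J)%E by apply: integral_ge0 => w _; rewrite lee_fin cosh_ge2.
have Jf : J \is a fin_num.
  rewrite ge0_fin_numE// (le_lt_trans (y := (J + 2%:E)%E))//; first by rewrite leeDl.
  by rewrite (le_lt_trans J2)// -EFinD ltry.
move: J2; rewrite -(fineK Jf) -!EFinD !lee_fin => J2.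
have h1 := expR_sub1_le (u n / 2).
have h2 : expR (u n / 2) <= expR U.
  by rewrite ler_expR; have := u_le n; have := u0 n; lra.
have h3 := ler_wpM2l (u0 n) h2.
by lra.
Qed.

Let E_Z2 n : (\int[P]_w (Z2 n w)%:E <= (u n)%:E)%E.
Proof.
have mZ i : measurable_fun setT
    (fun w => ((Y n (xi i w) (eta i w) / 2 ^+ n) ^+ 2)%:E).
  apply/measurable_EFinP/measurable_funX/measurable_funM => //.
  exact: (measurable_obs Xi_closed data (phi := Y n)).
rewrite (eq_integral (fun w => \sum_(i < 2 ^ n)
   ((Y n (xi i w) (eta i w) / 2 ^+ n) ^+ 2)%:E)%E); last first.
  by move=> w _; rewrite sumEFin.
rewrite ge0_integral_sum//; last by move=> i w _; rewrite lee_fin sqr_ge0.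
have -> : u n = \sum_(i < 2 ^ n) \sum_h (v n h / (2 ^+ n) ^+ 2).
  rewrite sumr_const card_ord -[_ *+ (2 ^ n)]mulr_natr natrX /u -!mulr_suml.
  by have := p2 n; move: (2 ^+ n) => a a0; field; rewrite gt_eqF.
rewrite -sumEFin; apply: lee_sum => i _.
apply: (expectation_obs_le Xi_closed q_density data
  (phi := fun x h => (Y n x h / 2 ^+ n) ^+ 2)) => [h|x h _|h].
- by apply/measurable_funX/measurable_funM.
- by rewrite sqr_ge0.
- rewrite mulrC EFinM /v /Rintegral fineK; last exact: integrable_fin_num.
  rewrite -integralZl//; apply: eq_integral => x _.
  by rewrite -EFinM exprMn exprVn; congr EFin; ring.
Qed.

(** The constant 4 is a price for elementary tools: one factor 2 pays for the
fluctuations of dyadic block sums, the other one for passing from dyadic times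
to all times.  It is harmless since the lemma is applied to functions [W] of
arbitrarily small mean.  Only first moments are required; the variances of the
truncated variables are summable by [sum_dyadic_truncation]. *)
Lemma ae_eventually_sum_le : {ae P, forall w, \forall N \near \oo,
  \sum_(i < N) W (xi i w) (eta i w) <= 4 * mu * N%:R}.
Proof.
have c0 : 0 <= 16 / mu ^+ 2 by rewrite divr_ge0// sqr_ge0.
have Xxi i w : Xi (xi i w) by exact: (xi_in_Xi data).
have Z1small : {ae P, forall w, \forall n \near \oo, Z1 n w < 1}.
  apply: (@ae_eventually_lt1 _ _ _ _ _ (U * (expR U * (16 / mu ^+ 2)))).
  - move=> n; apply: measurable_funM => //; apply: measurable_funB => //.
    apply: measurable_funD.
      by apply: measurableT_comp => //; exact: measurable_funM.
    by do 2!apply: measurableT_comp => //; exact: measurable_funM.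
  - by move=> n w; rewrite mulr_ge0// cosh_ge2.
  - move=> n; apply: (@le_trans _ _ (\sum_(k < n) (u k * (expR U * (16 / mu ^+ 2)))%:E)%E).
      by apply: lee_sum => k _; exact: E_Z1.
    rewrite sumEFin lee_fin -mulr_suml ler_wpM2r ?sum_u//.
    by rewrite mulr_ge0 ?expR_ge0.
have Z2small : {ae P, forall w, \forall n \near \oo, Z2 n w < 1}.
  apply: (@ae_eventually_lt1 _ _ _ _ _ U).
  - move=> n; apply: measurable_sum => i; apply/measurable_funX/measurable_funM => //.
    exact: (measurable_obs Xi_closed data (phi := Y n)).
  - by move=> n w; apply: sumr_ge0 => i _; rewrite sqr_ge0.
  - move=> n; apply: (@le_trans _ _ (\sum_(k < n) (u k)%:E)%E).
      by apply: lee_sum => k _; exact: E_Z2.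
    by rewrite sumEFin lee_fin sum_u.
apply: filterS2 Z1small Z2small => w [n1 _ z1] [n2 _ z2].
have block n : (n1 <= n)%N -> (n2 <= n)%N ->
    \sum_(i < 2 ^ n) W (xi i w) (eta i w) <= 2 * mu * 2 ^+ n.
  move=> /z1 /= {}z1 /z2 /= {}z2.
  have YW (i : 'I_(2 ^ n)) : W (xi i w) (eta i w) = Y n (xi i w) (eta i w).
    rewrite /Y; case: leP => // h; exfalso; move: z2; rewrite ltNge => /negP; apply.
    rewrite /Z2 (bigD1 i)//= {1}/Y minElt ltNge (ltW h)/= divff ?gt_eqF// expr1n.
    by rewrite lerDl sumr_ge0// => j _; rewrite sqr_ge0.
  have St : t n * S n w < mu / 2.
    rewrite ltNge; apply/negP => h; move: z1; rewrite ltNge => /negP; apply.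
    have h0 : 0 <= t n * S n w by apply: le_trans h; rewrite divr_ge0// ltW.
    have := sqr_le_cosh h0; rewrite /Z1; move: (_ + _ - 2) => k hk.
    rewrite mulrA ler_pdivlMr ?exprn_gt0// mul1r.
    have : (mu / 2) ^+ 2 <= (t n * S n w) ^+ 2.
      by rewrite lerXn2r// nnegrE// divr_ge0// ltW.
    by rewrite expr_div_n; lra.
  have {}St : S n w < mu * 2 ^+ n.
    move: St; rewrite /t exprS mulrC ltr_pdivrMr ?mulr_gt0//.
    by move=> /lt_le_trans; apply; lra.
  have : \sum_(i < 2 ^ n) m n (eta i w) <= mu * 2 ^+ n.
    have -> : mu * 2 ^+ n = \sum_(i < 2 ^ n) mu.
      by rewrite sumr_const card_ord -[_ *+ (2 ^ n)]mulr_natr natrX.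
    by apply: ler_sum => i _; exact: m_le.
  under eq_bigr do rewrite YW.
  by move: St; rewrite /S sumrB; lra.
exists (2 ^ maxn n1 n2)%N => // N /= hN.
have N0 : (0 < N)%N by apply: leq_trans hN; rewrite expn_gt0.
set n := trunc_log 2 N.
have nN : (2 ^ n <= N)%N by apply: trunc_logP.
have Nn : (N < 2 ^ n.+1)%N by apply: trunc_log_ltn.
have nn : (maxn n1 n2 <= n)%N by apply: trunc_log_max.
have := block n.+1 (leq_trans (leq_maxl _ _) (leqW nn))
  (leq_trans (leq_maxr _ _) (leqW nn)).
have : \sum_(i < N) W (xi i w) (eta i w) <=
    \sum_(i < 2 ^ n.+1) W (xi i w) (eta i w).
  rewrite -!(big_mkord xpredT (fun i => W (xi i w) (eta i w))).
  rewrite (@big_cat_nat _ _ _ N _ (2 ^ n.+1))//=; last exact: ltnW.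
  by rewrite lerDl sumr_ge0// => i _; exact: W0.
move=> /le_trans h /h /le_trans; apply.
rewrite exprS mulrA -[_ * 2]mulrA; have : (2 ^+ n : R) <= N%:R.
  by rewrite -natrX ler_nat.
by move=> /(ler_wpM2l (ltW mu0)); lra.
Qed.

End law_of_large_numbers.

(** * The state chain *)

Section chain_decay.
Context (R : realType) (H : finType) (varpi : H -> H -> R).
Context (varpi_stochastic : stochastic varpi).
Context (varpi_irreducible : irreducible_chain varpi).
Context (r : H -> R) (h0 : H) (r01 : forall h, 0 < r h <= 1) (rh0 : r h0 < 1).

(* The transition operator penalized by [r]. *)
Let T (w : H -> R) h := r h * \sum_h' varpi h h' * w h'.

Let Tk k := iter k T (cst 1).

Let vp0 h h' : 0 <= varpi h h'. Proof. exact: varpi_stochastic.1. Qed.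
Let r0 h : 0 < r h. Proof. by have /andP[] := r01 h. Qed.
Let r1 h : r h <= 1. Proof. by have /andP[] := r01 h. Qed.

Let T_mono u w h : (forall h, u h <= w h) -> T u h <= T w h.
Proof.
move=> uw; rewrite ler_pM2l//; apply: ler_sum => h' _; exact: ler_wpM2l.
Qed.

Let Tk0 k h : 0 <= Tk k h.
Proof.
elim: k h => [|k IH] h /=; first exact: ler01.
by rewrite mulr_ge0 ?sumr_ge0 ?(ltW (r0 h))// => h' _; rewrite mulr_ge0.
Qed.

Let TkS k h : Tk k.+1 h <= Tk k h.
Proof.
elim: k h => [|k IH] h; last exact: T_mono.
rewrite /= /T; under eq_bigr do rewrite mulr1.
by rewrite varpi_stochastic.2 mulr1.
Qed.

Let Tk_mono j k h : (j <= k)%N -> Tk k h <= Tk j h.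
Proof.
move=> /subnK <-; elim: (k - j)%N => [|n IH] //.
by rewrite addSn; exact: le_trans (TkS _ _) IH.
Qed.

Let Tk1 k h : Tk k h <= 1. Proof. exact: (Tk_mono h (leq0n k)). Qed.

Let Tk_lt1 k h : 0 < nstep varpi k h h0 -> Tk k.+1 h < 1.
Proof.
elim: k h => [|k IH] h /=.
  case: eqP => [-> _|_]; last by rewrite ltxx.
  rewrite /= /T; under eq_bigr do rewrite mulr1.
  by rewrite varpi_stochastic.2 mulr1.
move=> S0; have /psumr_neq0P : \sum_l varpi h l * nstep varpi k l h0 <> 0.
  by move/eqP; rewrite gt_eqF.
case=> [l _|l /= vn]; first by rewrite mulr_ge0// nstep_ge0.
have nl : 0 < nstep varpi k l h0.
  by rewrite lt0r nstep_ge0// andbT; apply: contraTN vn => /eqP ->; rewrite mulr0 ltxx.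
have vl : 0 < varpi h l.
  by rewrite lt0r vp0 andbT; apply: contraTN vn => /eqP ->; rewrite mul0r ltxx.
apply: (@le_lt_trans _ _ (\sum_h' varpi h h' * Tk k.+1 h')).
  by rewrite ler_piMl// sumr_ge0// => h' _; apply: mulr_ge0 => //; exact: (Tk0 k.+1).
rewrite -(varpi_stochastic.2 h) (bigD1 l)//= [ltRHS](bigD1 l)//=.
apply: ltr_leD; first by rewrite gtr_pMr// IH.
by apply: ler_sum => h' _; apply: ler_piMr => //; exact: (Tk1 k.+1).
Qed.

(** Irreducibility lets the chain reach the penalized state [h0] from everywhere,
so some iterate of the penalized operator maps 1 below a constant smaller than
1.  The sum of the previous iterates is then strictly contracted: each visit to
[h0] costs something, and visits are frequent. *)
Lemma lyapunov_function : exists (w : H -> R) (a : R), [/\ 0 < a,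
  forall h, 1 <= w h &
  forall h, r h * (\sum_h' varpi h h' * w h') <= expR (- a) * w h].
Proof.
have /choice[k kP] : forall h, exists k, 0 < nstep varpi k h h0.
  by move=> h; exact: varpi_irreducible.
pose K := (\max_h k h).+1.
have TK h : Tk K h < 1.
  apply: le_lt_trans (Tk_lt1 (kP h)); apply: Tk_mono.
  by rewrite ltnS; exact: leq_bigmax.
pose M := \big[Num.max/0]_h Tk K h.
have M1 : M < 1 by apply: bigmax_lt.
have TM h : Tk K h <= M by exact: le_bigmax.
have K0 : 0 < K%:R :> R by rewrite ltr0n.
pose w h := \sum_(k < K) Tk k h.
have wK h : w h <= K%:R.
  by rewrite -[K in leRHS]card_ord -sumr_const; apply: ler_sum => i _.
exists w, ((1 - M) / K%:R); split.
- by rewrite divr_gt0// subr_gt0.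
- by move=> h; rewrite /w big_ord_recl lerDl sumr_ge0.
move=> h; apply: (@le_trans _ _ ((1 - (1 - M) / K%:R) * w h)); last first.
  rewrite ler_wpM2r ?sumr_ge0//.
  by apply: le_trans (expR_ge1Dx _).
have -> : r h * (\sum_h' varpi h h' * w h') = w h - 1 + Tk K h.
  under eq_bigr do rewrite mulr_sumr.
  rewrite exchange_big /= mulr_sumr.
  rewrite [LHS](_ : _ = \sum_(i < K) Tk i.+1 h)//.
  by rewrite /w big_ord_recr big_ord_recl /=; lra.
have : (1 - M) / K%:R * w h <= 1 - M.
  rewrite mulrAC ler_pdivrMr// ler_wpM2l// subr_ge0; exact: ltW.
by have := TM h; lra.
Qed.

End chain_decay.

Section chain_process.
Context (R : realType) (H : finType) (d : nat) (Xi : set 'rV[R]_d).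
Context (varpi : H -> H -> R) (q : 'rV[R]_d -> H -> R).
Context (disp : measure_display) (Omega : measurableType disp).
Context (P : probability Omega R) (eta1 : H).
Context (xi : nat -> Omega -> 'rV[R]_d) (eta : nat -> Omega -> H).
Context (varpi_stochastic : stochastic varpi).
Context (data : data_process Xi varpi q P eta1 xi eta).

(** The likelihood contains the transition probabilities of the observed path;
this keeps them from vanishing. *)
Lemma ae_transition_gt0 :
  {ae P, forall w, forall i, 0 < varpi (eta i w) (eta i.+1 w)}.
Proof.
apply: ae_foralln => i.
suff : {ae P, forall w, forall z : H * H, varpi z.1 z.2 = 0 ->
    ~ (eta i w = z.1 /\ eta i.+1 w = z.2)}.
  apply: filterS => w h; rewrite lt0r varpi_stochastic.1 andbT.
  by apply/eqP => /(h (eta i w, eta i.+1 w)); apply.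
apply: filter_forall => z.
have [vz|vz] := eqVneq (varpi z.1 z.2) 0; last first.
  by apply: aeW => w /eqP; rewrite (negbTE vz).
have mA := measurable_eta data i z.1; have mB := measurable_eta data i.+1 z.2.
exists (eta i.+1 @^-1` [set z.2] `&` eta i @^-1` [set z.1]); split.
- exact: measurableI.
- have [PA|PA] := eqVneq (P (eta i @^-1` [set z.1])) 0%E.
    by apply: subset_measure0 PA => //; exact: measurableI.
  have {}PA : (0 < P (eta i @^-1` [set z.1]))%E by rewrite lt0e PA measure_ge0.
  have := eta_transition data z.2 PA; rewrite vz /cprob => /eqP.
  rewrite mulf_eq0 invr_eq0 => /orP[|] /eqP fP.
    by rewrite -[LHS]fineK ?fP// fin_num_measure//; exact: measurableI.
  by move: PA; rewrite -(fineK (fin_num_measure P _ mA)) fP ltxx.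
- by move=> w /= /not_implyP[_ /contrapT[? ?]].
Qed.

Lemma measurable_eta_fun (g : H -> R) i :
  measurable_fun setT (fun w => g (eta i w)).
Proof.
rewrite (_ : (fun w => _) = (fun w => \sum_h g h * \1_(eta i @^-1` [set h]) w)).
  apply: measurable_sum => h; apply: measurable_funM => //.
  exact/measurable_indic/(measurable_eta data).
apply/funext => w; rewrite (bigD1 (eta i w))//= indicE mem_set//= mulr1.
rewrite big1 ?addr0// => h hne; rewrite indicE memNset ?mulr0//= => ehw.
by rewrite ehw eqxx in hne.
Qed.

(** The Markov property, integrated: a function of the path up to time [N] is
constant on each of the finitely many path events. *)
Lemma chain_step (r w : H -> R) N : (forall h, 0 <= r h) -> (forall h, 0 <= w h) ->
  (\int[P]_om (\prod_(i < N.+1) r (eta i om) * w (eta N.+1 om))%:E =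
   \int[P]_om (\prod_(i < N.+1) r (eta i om) *
                \sum_h' varpi (eta N om) h' * w h')%:E)%E.
Proof.
move=> r0 w0.
pose e (om : Omega) : {ffun 'I_N.+1 -> H} := [ffun i : 'I_N.+1 => eta i om].
have eP tau : e @^-1` [set tau] =
    [set om | forall i, (i <= N)%N -> eta i om = tau (inord i)].
  apply/seteqP; split => [om /= <- i iN|om /= h].
    by rewrite ffunE inordK.
  by apply/ffunP => i; rewrite ffunE h ?inord_val// -ltnS.
have me tau : measurable (e @^-1` [set tau]).
  rewrite (_ : e @^-1` _ = \bigcap_i (eta (i : 'I_N.+1) @^-1` [set tau i])).
    by apply: fin_bigcap_measurable => // i _; exact: (measurable_eta data).
  apply/seteqP; split => [om /= <- i _ /=|om h]; first by rewrite ffunE.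
  by apply/ffunP => i; rewrite ffunE; exact: (h i).
have mr : measurable_fun setT (fun om => \prod_(i < N.+1) r (eta i om)).
  by apply: measurable_prod => i _; exact: measurable_eta_fun.
have s0 h : 0 <= \sum_h' varpi h h' * w h'.
  by apply: sumr_ge0 => h' _; rewrite mulr_ge0// varpi_stochastic.1.
rewrite (integral_by_value _ me)//; last 2 first.
- by apply/measurable_EFinP/measurable_funM => //; exact: measurable_eta_fun.
- by move=> om; rewrite lee_fin mulr_ge0// prodr_ge0.
rewrite [RHS](integral_by_value _ me)//; last 2 first.
- apply/measurable_EFinP/measurable_funM => //.
  exact: (measurable_eta_fun (fun h => \sum_h' varpi h h' * w h')).
- by move=> om; rewrite lee_fin mulr_ge0// prodr_ge0.
apply: eq_bigr => tau _; set E := e @^-1` [set tau].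
have etaE om (i : 'I_N.+1) : E om -> eta i om = tau i by move=> <-; rewrite ffunE.
pose rt := \prod_(i < N.+1) r (tau i).
have rt0 : 0 <= rt by exact: prodr_ge0.
rewrite (eq_integral (fun om => rt%:E * (w (eta N.+1 om))%:E)%E); last first.
  move=> om /[!inE] Eo; rewrite -EFinM; congr (_ * _)%:E.
  by apply: eq_bigr => i _; rewrite (etaE _ _ Eo).
rewrite [RHS](eq_integral (fun=> (rt * \sum_h' varpi (tau ord_max) h' * w h')%:E)).
  2: by move=> om /[!inE] Eo; rewrite -(etaE _ _ Eo); congr (_ * _)%:E;
    apply: eq_bigr => i _; rewrite (etaE _ _ Eo).
have mE : measurable E := me tau.
have mw : measurable_fun E (fun om => (w (eta N.+1 om))%:E).
  by apply/measurable_EFinP/measurable_funTS; exact: measurable_eta_fun.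
rewrite ge0_integralZl_EFin//; last by move=> om _; rewrite lee_fin.
rewrite [RHS]integral_cst// EFinM -muleA; congr (_ * _)%E.
rewrite (eq_integral (fun om => \sum_h' (w h')%:E *
   (\1_(eta N.+1 @^-1` [set h']) om)%:E)%E); last first.
  move=> om _; rewrite (bigD1 (eta N.+1 om))//= indicE mem_set//= mule1.
  rewrite big1 ?adde0// => h hne; rewrite indicE memNset ?mule0//= => ehw.
  by rewrite ehw eqxx in hne.
have mi h' : measurable (eta N.+1 @^-1` [set h']) by exact: (measurable_eta data).
have mei h' : measurable_fun E (fun om => (\1_(eta N.+1 @^-1` [set h']) om)%:E : \bar R).
  by apply/measurable_EFinP; exact: measurable_indic.
rewrite ge0_integral_sum//; last 2 first.
- by move=> h'; exact: measurable_funeM.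
- by move=> h' om _; rewrite mule_ge0// lee_fin.
rewrite -sumEFin ge0_sume_distrl; last first.
  by move=> h' _; rewrite lee_fin mulr_ge0// varpi_stochastic.1.
apply: eq_bigr => h' _.
rewrite ge0_integralZl_EFin//.
rewrite integral_indic// mulrC EFinM -muleA; congr (_ * _)%E.
have [PE0|PE0] := eqVneq (P E) 0%E.
  transitivity (0 : \bar R)%E.
    by apply: subset_measure0 PE0 => //; exact: measurableI.
  by apply/esym; apply: etrans (mule0 _); congr (_ * _)%E.
have {}PE0 : (0 < P E)%E by rewrite lt0e PE0 measure_ge0.
have PEf := fin_num_measure P E (me tau).
have fE : 0 < fine (P E) by rewrite fine_gt0// PE0 ltey_eq PEf.
have sub : E `<=` eta N @^-1` [set tau (inord N)].
  by move=> om; rewrite /E eP => /(_ N (leqnn _)).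
have PN : (0 < P (eta N @^-1` [set tau (inord N)]))%E.
  apply: lt_le_trans PE0 _; apply: le_measure; rewrite ?inE//.
  exact: (measurable_eta data).
have := @eta_markov _ _ _ _ _ _ _ _ _ _ _ _ data N (fun i => tau (inord i)) h'.
rewrite /= -eP -/E => /(_ PE0); rewrite (eta_transition data)// /cprob.
have -> : inord N = ord_max :> 'I_N.+1 by apply/val_inj; rewrite /= inordK.
move=> /(canRL (divfK (lt0r_neq0 fE))) => eqn.
rewrite -(fineK (fin_num_measure P _ (measurableI _ _ (mi h') (me tau)))) eqn.
by rewrite EFinM fineK.
Qed.

End chain_process.

(** * Exponential decay of a single likelihood ratio *)

Lemma ae_eventually_lt1_geometric (R : realType) d (T : measurableType d)
    (mu : {measure set T -> \bar R}) (X : nat -> T -> R) (C rho : R) :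
  0 <= C -> 0 <= rho < 1 ->
  (forall n, measurable_fun setT (X n)) -> (forall n w, 0 <= X n w) ->
  (forall n, (\int[mu]_w (X n w)%:E <= (C * rho ^+ n)%:E)%E) ->
  {ae mu, forall w, \forall n \near \oo, X n w < 1}.
Proof.
move=> C0 /andP[r0 r1] mX X0 XC; apply: (ae_eventually_lt1 mX X0 (C := C / (1 - rho))).
move=> n; apply: (@le_trans _ _ (\sum_(k < n) (C * rho ^+ k)%:E)%E).
  by apply: lee_sum => k _; exact: XC.
have r1' : 0 < 1 - rho by rewrite subr_gt0.
rewrite sumEFin lee_fin -mulr_sumr ler_wpM2l// -div1r ler_pdivlMr//.
rewrite mulrC -opprB mulNr -subrX1 opprB gerBl exprn_ge0//.
Qed.

Section decay.
Context (R : realType) (H : finType) (d : nat) (Xi : set 'rV[R]_d).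
Context (varpi : H -> H -> R) (q : 'rV[R]_d -> H -> R).
Context (disp : measure_display) (Omega : measurableType disp).
Context (P : probability Omega R) (eta1 : H).
Context (xi : nat -> Omega -> 'rV[R]_d) (eta : nat -> Omega -> H).
Context (Xi_closed : closed Xi) (q_density : forall h, is_density Xi (q^~ h)).
Context (varpi_stochastic : stochastic varpi).
Context (varpi_irreducible : irreducible_chain varpi).
Context (data : data_process Xi varpi q P eta1 xi eta).

Let mXi : measurable Xi := closed_measurable_rV Xi_closed.

(** Positive frequency of visits to [h0], in the exponential form in which it is
used: each visit multiplies by [r h0 < 1]. *)
Lemma ae_visits_decay (r : H -> R) (h0 : H) :
  (forall h, 0 < r h <= 1) -> r h0 < 1 ->
  exists2 a : R, 0 < a & {ae P, forall w, \forall N \near \oo,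
    \prod_(i < N) r (eta i w) <= expR (- a * N%:R)}.
Proof.
move=> r01 rh0.
have [w [a [a0 w1 Tw]]] := lyapunov_function varpi_stochastic varpi_irreducible r01 rh0.
have w0 h : 0 <= w h by apply: le_trans (w1 h); exact: ler01.
have r0 h : 0 <= r h by have /andP[/ltW] := r01 h.
have s0 h : 0 <= \sum_h' varpi h h' * w h'.
  by apply: sumr_ge0 => h' _; rewrite mulr_ge0// varpi_stochastic.1.
have mr N : measurable_fun setT (fun om => \prod_(i < N) r (eta i om)).
  by apply: measurable_prod => i _; exact: (measurable_eta_fun data).
have mrw N : measurable_fun setT
    (fun om => (\prod_(i < N) r (eta i om) * w (eta N om))%:E).
  by apply/measurable_EFinP/measurable_funM => //; exact: (measurable_eta_fun data).
pose C := \sum_h w h.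
have C0 : 0 <= C by exact: sumr_ge0.
have wC h : w h <= C by rewrite /C (bigD1 h)//= lerDl sumr_ge0.
have E N : (\int[P]_om (\prod_(i < N) r (eta i om) * w (eta N om))%:E <=
    (C * expR (- a) ^+ N)%:E)%E.
  elim: N => [|N IH].
    apply: (@le_trans _ _ (\int[P]_om (cst C%:E om))%E).
      apply: ge0_le_integral => //.
      - by move=> om _; rewrite big_ord0 mul1r lee_fin.
      - by move=> om _; rewrite big_ord0 mul1r lee_fin.
    by rewrite integral_cst//= probability_setT mule1 expr0 mulr1.
  rewrite (chain_step varpi_stochastic data)// exprS mulrCA EFinM.
  apply: (le_trans _ (lee_wpmul2l _ IH)); last by rewrite lee_fin expR_ge0.
  rewrite -ge0_integralZl_EFin//; last first.
    by move=> om _; rewrite lee_fin mulr_ge0// prodr_ge0.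
  apply: ge0_le_integral => //.
  - by move=> om _; rewrite lee_fin mulr_ge0// prodr_ge0.
  - apply/measurable_EFinP/measurable_funM => //.
    exact: (measurable_eta_fun data (fun h => \sum_h' varpi h h' * w h')).
  - exact: measurable_funeM.
  - move=> om _; rewrite -EFinM lee_fin big_ord_recr/= -mulrA [leRHS]mulrCA.
    by rewrite ler_wpM2l ?prodr_ge0.
exists (a / 2); first by rewrite divr_gt0.
have := @ae_eventually_lt1_geometric _ _ _ P
  (fun N om => expR (a / 2) ^+ N * \prod_(i < N) r (eta i om)) C (expR (- (a / 2))) C0.
have e1 : 0 <= expR (- (a / 2)) < 1 by rewrite expR_ge0 expR_lt1; lra.
move=> /(_ e1); set Q := (X in _ -> _ -> _ -> X) => h.
suff : Q.
  apply: filterS => om; apply: filterS => N.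
  rewrite -expRM_natl mulrC -[X in _ * X]invrK -expRN => /ltW.
  rewrite ler_pdivrMr ?expR_gt0// mul1r.
  by move=> /le_trans; apply; rewrite ler_expR; lra.
apply: h.
- by move=> N; exact: measurable_funM.
- by move=> N om; rewrite mulr_ge0 ?exprn_ge0 ?expR_ge0// prodr_ge0.
move=> N; under eq_integral do rewrite EFinM.
rewrite ge0_integralZl_EFin//; last 2 first.
- by move=> om _; rewrite lee_fin prodr_ge0.
- exact/measurable_EFinP.
have -> : C * expR (- (a / 2)) ^+ N = expR (a / 2) ^+ N * (C * expR (- a) ^+ N).
  by rewrite mulrCA -exprMn -expRD; congr (_ * expR _ ^+ _); lra.
rewrite EFinM lee_wpmul2l ?lee_fin ?exprn_ge0 ?expR_ge0//.
apply: le_trans (E N); apply: ge0_le_integral => //.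
- by move=> om _; rewrite lee_fin prodr_ge0.
- exact/measurable_EFinP.
- by move=> om _; rewrite lee_fin ler_peMr ?prodr_ge0.
Qed.

(* The square root of a positive number, in a form compatible with [ln]. *)
Let half_ln (y : R) := expR (ln y / 2).

Let half_ln_sqr y : 0 < y -> half_ln y ^+ 2 = y.
Proof.
by move=> y0; rewrite expr2 -expRD -splitr lnK.
Qed.

Let half_lnD (y z : R) : 0 < z ->
  expR ((ln y - ln z) / 2) * z = half_ln y * half_ln z.
Proof.
by move=> z0; rewrite -[X in _ * X]lnK// -!expRD; congr expR; lra.
Qed.

(** The integral is the Hellinger affinity of [g] and [q], that is, one minus half
the integral of [(sqrt g - sqrt q) ^+ 2]; it equals 1 only if the two densities
agree almost everywhere. *)
Lemma hellinger_affinity (g : 'rV[R]_d -> R) h :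
  (forall x, Xi x -> 0 < q x h) -> (forall x, Xi x -> 0 < g x) ->
  is_density Xi g ->
  (\int[lebesgue_rV R d]_(x in Xi)
     (expR ((ln (g x) - ln (q x h)) / 2) * q x h)%:E <= 1)%E /\
  ((\int[lebesgue_rV R d]_(x in Xi) `|g x - q x h|%:E != 0)%E ->
   (\int[lebesgue_rV R d]_(x in Xi)
     (expR ((ln (g x) - ln (q x h)) / 2) * q x h)%:E < 1)%E).
Proof.
move=> q_gt0 g_gt0 [mg g0 g1]; have [mq q0 q1] := q_density h.
pose s x := half_ln (g x); pose t x := half_ln (q x h).
have s0 x : 0 <= s x by exact: expR_ge0.
have t0 x : 0 <= t x by exact: expR_ge0.
have mhalf (k : 'rV[R]_d -> R) : measurable_fun Xi k ->
    measurable_fun Xi (fun x => half_ln (k x)).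
  move=> mk; rewrite /half_ln; apply: measurableT_comp => //.
  apply: measurable_funM => //.
  exact: measurableT_comp.
have ms : measurable_fun Xi s by exact: mhalf.
have mt : measurable_fun Xi t by exact: mhalf.
set A := (\int[_]_(x in _) _)%E.
pose J := (\int[lebesgue_rV R d]_(x in Xi) ((s x - t x) ^+ 2)%:E)%E.
have mJ : measurable_fun Xi (fun x => ((s x - t x) ^+ 2)%:E).
  by apply/measurable_EFinP/measurable_funX/measurable_funB.
have J0 : (0 <= J)%E by apply: integral_ge0 => x _; rewrite lee_fin sqr_ge0.
have AE : A = (\int[lebesgue_rV R d]_(x in Xi) (s x * t x)%:E)%E.
  by apply: eq_integral => x /[!inE] Xx; rewrite half_lnD// q_gt0.
have A0 : (0 <= A)%E.
  by rewrite AE; apply: integral_ge0 => x _; rewrite lee_fin mulr_ge0.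
have mA : measurable_fun Xi (fun x => (s x * t x)%:E).
  by apply/measurable_EFinP/measurable_funM.
have key : (J + 2%:E * A = 2%:E)%E.
  rewrite AE -ge0_integralZl_EFin//; last first.
    by move=> x _; rewrite lee_fin mulr_ge0.
  rewrite -ge0_integralD//; last 3 first.
  - by move=> x _; rewrite lee_fin sqr_ge0.
  - by move=> x _; rewrite -EFinM lee_fin !mulr_ge0.
  - exact: measurable_funeM.
  rewrite (eq_integral (fun x => (g x)%:E + (q x h)%:E)%E); last first.
    move=> x /[!inE] Xx; rewrite -EFinM -!EFinD; congr EFin.
    rewrite -[X in _ = X + _]half_ln_sqr ?g_gt0//.
    by rewrite -[X in _ = _ + X]half_ln_sqr ?q_gt0// -/(s x) -/(t x); ring.
  rewrite ge0_integralD//; do ?[by move=> x Xx; rewrite lee_fin ?g0 ?q0];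
    do ?exact/measurable_EFinP.
  by rewrite g1 q1 -EFinD.
have Af : A \is a fin_num.
  rewrite ge0_fin_numE// ltNge leye_eq; apply/negP => /eqP Ay.
  move: key; rewrite Ay gt0_muley ?lte_fin// addey//.
  by rewrite -ltNye (lt_le_trans _ J0).
have Jf : J \is a fin_num.
  rewrite ge0_fin_numE// ltNge leye_eq; apply/negP => /eqP Jy.
  by move: key; rewrite Jy -(fineK Af) -EFinM addye.
have A1 : (A <= 1)%E.
  move: key J0; rewrite -(fineK Af) -(fineK Jf) -EFinM -EFinD !lee_fin => -[].
  by lra.
split=> //; apply: contraNT; rewrite -leNgt => A1'.
have {A1 A1'} A1 : A = 1%E by apply/eqP; rewrite eq_le A1.
have {J0}J0 : J = 0%E.
  by move: key; rewrite A1 mule1 -(fineK Jf) -EFinD => -[] ?; congr EFin; lra.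
have ae0 : ae_eq (lebesgue_rV R d) Xi (fun x => ((s x - t x) ^+ 2)%:E) (cst 0%E).
  apply/(ae_eq_integral_abs (lebesgue_rV R d) mXi mJ).
  rewrite -J0; apply: eq_integral => x _.
  by rewrite abse_EFin ger0_norm ?sqr_ge0.
apply/eqP.
have mgq : measurable_fun Xi (fun x => `|g x - q x h|%:E).
  by apply/measurable_EFinP/measurableT_comp => //; exact: measurable_funB.
rewrite (@ae_eq_integral _ _ _ (lebesgue_rV R d) Xi (cst 0%E))//.
  by rewrite integral0.
apply: filterS ae0 => x /= h0 Xx; have [] := h0 Xx.
move=> /eqP; rewrite sqrf_eq0 subr_eq0 => /eqP st.
rewrite -[g x]half_ln_sqr ?g_gt0// -[q x h]half_ln_sqr ?q_gt0//.
by rewrite -/(s x) -/(t x) st subrr normr0.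
Qed.

(** The square root of the likelihood ratio, divided by upper bounds for the
affinities of the visited states, is a supermartingale of expectation at most 1.
The bound at [h0] is smaller than 1, so [ae_visits_decay] makes the product of
these bounds exponentially small. *)
Lemma ae_log_likelihood_ratio_decay (g : 'rV[R]_d -> H -> R) (h0 : H) :
  (forall x h, Xi x -> 0 < q x h) -> (forall x h, Xi x -> 0 < g x h) ->
  (forall h, is_density Xi (g^~ h)) ->
  (\int[lebesgue_rV R d]_(x in Xi) `|g x h0 - q x h0|%:E != 0)%E ->
  exists2 a : R, 0 < a & {ae P, forall w, \forall N \near \oo,
    \sum_(i < N) (ln (g (xi i w) (eta i w)) - ln (q (xi i w) (eta i w))) <=
    - a * N%:R}.
Proof.
move=> q_gt0 g_gt0 g_density gq.
have aff h := hellinger_affinity (fun x => @q_gt0 x h) (fun x => @g_gt0 x h) (g_density h).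
pose ell x h := ln (g x h) - ln (q x h).
pose A h := (\int[lebesgue_rV R d]_(x in Xi) (expR (ell x h / 2) * q x h)%:E)%E.
have A1 h : (A h <= 1)%E := (aff h).1.
have A2 : (A h0 < 1)%E := (aff h0).2 gq.
have q0 x h : Xi x -> 0 <= q x h by move=> Xx; rewrite ltW// q_gt0.
have A0 h : (0 <= A h)%E.
  by apply: integral_ge0 => x Xx; rewrite lee_fin mulr_ge0 ?expR_ge0 ?q0.
have Af h : A h \is a fin_num by rewrite ge0_fin_numE// (le_lt_trans (A1 h))// ltry.
(* The affinity may vanish, while the penalty of a visit has to be positive. *)
pose rho := Num.max (fine (A h0)) 2^-1.
have rho0 : 0 < rho by rewrite lt_max invr_gt0 ltr0n orbT.
have rho1 : rho < 1.
  by rewrite gt_max -lte_fin fineK// A2/=; lra.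
pose r h := if h == h0 then rho else 1.
have r01 h : 0 < r h <= 1.
  rewrite /r; case: ifP => _; last by rewrite ltr01 lexx.
  by rewrite rho0 ltW.
have rh0 : r h0 < 1 by rewrite /r eqxx.
have r0 h : 0 < r h by have /andP[] := r01 h.
have Ar h : (A h <= (r h)%:E)%E.
  rewrite /r; case: eqP => [->|_]; last exact: A1.
  by rewrite -(fineK (Af h0)) lee_fin le_max lexx.
have [a a0 va] := ae_visits_decay r01 rh0.
exists a => //.
pose phi x h := (r h)^-1 * expR (ell x h / 2).
have mell h : measurable_fun Xi (fun x => expR (ell x h / 2)).
  have [mg _ _] := g_density h; have [mq _ _] := q_density h.
  apply: measurableT_comp => //; apply: measurable_funM => //.
  by apply: measurable_funB; exact: measurableT_comp.
have mphi h : measurable_fun Xi (phi^~ h) by exact: measurable_funM.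
have phi0 x h : 0 <= phi x h by rewrite mulr_ge0 ?expR_ge0// invr_ge0 ltW.
have phi1 h : (\int[lebesgue_rV R d]_(x in Xi) (phi x h * q x h)%:E <= 1)%E.
  have [mq _ _] := q_density h.
  rewrite (eq_integral (fun x => (r h)^-1%:E * (expR (ell x h / 2) * q x h)%:E)%E).
    2: by move=> x _; rewrite -EFinM mulrA.
  rewrite ge0_integralZl_EFin//; last 3 first.
  - by move=> x Xx; rewrite lee_fin mulr_ge0 ?expR_ge0 ?q0.
  - by apply/measurable_EFinP; exact: measurable_funM.
  - by rewrite invr_ge0 ltW.
  apply: (@le_trans _ _ ((r h)^-1%:E * (r h)%:E)%E).
    by apply: lee_wpmul2l; [rewrite lee_fin invr_ge0 ltW|exact: Ar].
  by rewrite -EFinM mulVf ?gt_eqF.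
have E1 := expectation_prod_le1 Xi_closed q_density data mphi
  (fun x h _ => phi0 x h) phi1.
have e1 : 0 <= expR (- (a / 2)) < 1 by rewrite expR_ge0 expR_lt1; lra.
have small : {ae P, forall w, \forall N \near \oo,
    expR (- (a / 2)) ^+ N * \prod_(i < N) phi (xi i w) (eta i w) < 1}.
  apply: (@ae_eventually_lt1_geometric _ _ _ P _ 1 (expR (- (a / 2))) ler01 e1).
  - move=> N; apply: measurable_funM => //; apply: measurable_prod => i _.
    exact: (measurable_obs Xi_closed data).
  - by move=> N om; rewrite mulr_ge0 ?exprn_ge0 ?expR_ge0// prodr_ge0.
  - move=> N; under eq_integral do rewrite EFinM.
    rewrite ge0_integralZl_EFin//; last 2 first.
    + by move=> om _; rewrite lee_fin prodr_ge0.
    + apply/measurable_EFinP/measurable_prod => i _.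
      exact: (measurable_obs Xi_closed data).
    by rewrite mul1r -[leRHS]mule1 lee_wpmul2l// lee_fin exprn_ge0// expR_ge0.
apply: filterS2 va small => w va small.
near=> N.
have v : \prod_(i < N) r (eta i w) <= expR (- a * N%:R) by near: N.
have sm : expR (- (a / 2)) ^+ N * \prod_(i < N) phi (xi i w) (eta i w) < 1 by near: N.
have {}sm : \prod_(i < N) phi (xi i w) (eta i w) < expR (a / 2 * N%:R).
  move: sm; rewrite -expRM_natl mulrN expRN mulrC ltr_pdivrMr ?expR_gt0// mul1r.
  by rewrite [N%:R * _]mulrC.
have prodE : \prod_(i < N) phi (xi i w) (eta i w) * \prod_(i < N) r (eta i w) =
    expR ((\sum_(i < N) ell (xi i w) (eta i w)) / 2).
  rewrite mulr_suml expR_sum -big_split /=; apply: eq_bigr => i _.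
  by rewrite /phi mulrAC mulVf ?mul1r// gt_eqF.
have : expR ((\sum_(i < N) ell (xi i w) (eta i w)) / 2) <=
    expR (a / 2 * N%:R) * expR (- a * N%:R).
  rewrite -prodE; apply: ler_pM (ltW sm) v; apply: prodr_ge0 => // i _.
  exact: ltW.
rewrite -expRD ler_expR /ell; lra.
Unshelve. all: by end_near.
Qed.

End decay.

(** * Local uniformity in the parameter *)

(** Separability of subsets of [R^n]; option-valued enumerations include the
empty set. *)
Lemma countable_dense_subset_rV (R : realType) n (A : set 'rV[R]_n) :
  exists (I : countType) (c : I -> option 'rV[R]_n),
    (forall i v, c i = Some v -> A v) /\
    forall B, open B -> forall v, A v -> B v ->
      exists i, exists2 u, c i = Some u & B u.
Proof.
pose box (k : {ffun 'I_n -> rat * rat}) : set 'rV[R]_n :=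
  [set v | forall i, v ord0 i \in `]ratr (k i).1, ratr (k i).2[%R].
have /choice[c cP] : forall k, exists u : option 'rV[R]_n,
    if u is Some v then A v /\ box k v else ~ exists v, A v /\ box k v.
  move=> k; have [[v h]|h] := pselect (exists v, A v /\ box k v).
    by exists (Some v).
  by exists None.
exists {ffun 'I_n -> rat * rat}, c; split=> [k v ckv|B oB v Av Bv].
  by have := cP k; rewrite ckv => -[].
have /nbhs_ballP[e /= e0 eB] : nbhs v B by exact: open_nbhs_nbhs.
have /choice[a aP] : forall i, exists q : rat,
    ratr q \in `](v ord0 i - e / 2), (v ord0 i)[%R.
  by move=> i; apply: rat_in_itvoo; rewrite ltrBlDr ltrDl divr_gt0.
have /choice[b bP] : forall i, exists q : rat,
    ratr q \in `](v ord0 i), (v ord0 i + e / 2)[%R.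
  by move=> i; apply: rat_in_itvoo; rewrite ltrDl divr_gt0.
pose k := [ffun i => (a i, b i)].
have bv : box k v.
  move=> i; rewrite ffunE/= in_itv/=.
  have := aP i; have := bP i; rewrite !in_itv/= => /andP[b1 _] /andP[_ a2].
  by rewrite a2 b1.
exists k; have := cP k; case: (c k) => [u [Au bu]|h]; last by exfalso; apply: h; exists v.
exists u => //; apply: eB; split => // i j; rewrite ord1.
have := bu j; rewrite ffunE/= in_itv/= => /andP[au bu'].
have := aP j; have := bP j; rewrite !in_itv/= => /andP[b1 b2] /andP[a1 a2].
by rewrite /ball/= ltr_norml; apply/andP; split; lra.
Qed.

Section local_oscillation.
Context (R : realType) (d s : nat) (Xi : set 'rV[R]_d) (Theta : set 'rV[R]_s).
Context (ell : 'rV[R]_d -> 'rV[R]_s -> R) (g : 'rV[R]_d -> R).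
Context (mXi : measurable Xi).
Context (mell : forall t, Theta t -> measurable_fun Xi (ell^~ t)).
Context (ell_continuous : forall x, Xi x -> {within Theta, continuous (ell x)}).
Context (ell_g : forall x t, Xi x -> Theta t -> `|ell x t| <= g x).
Context (t0 : 'rV[R]_s) (Tt0 : Theta t0).

Let osc_set (k : nat) x :=
  [set `|ell x t - ell x t0| | t in Theta `&` (ball t0 k.+1%:R^-1)°].

(** The variation of [ell x] on [Theta] around [t0].  Using the interior of a ball
makes the neighbourhood open, so that the supremum can be taken over a countable
dense set. *)
Definition oscillation k x := sup (osc_set k x).


Let center (k : nat) : (ball t0 (k.+1%:R^-1 : R))° t0.
Proof. exact: nbhsx_ballx. Qed.

Let osc_le x t : Xi x -> Theta t -> `|ell x t - ell x t0| <= 2 * g x.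
Proof.
move=> Xx Tt; apply: (le_trans (ler_normB _ _)).
by have := ell_g Xx Tt; have := ell_g Xx Tt0; lra.
Qed.

Let osc_sup k x : Xi x -> has_sup (osc_set k x).
Proof.
move=> Xx; split; first by exists `|ell x t0 - ell x t0|, t0 => //; split => //; exact: center.
by exists (2 * g x) => _ [t [Tt _] <-]; exact: osc_le.
Qed.

Lemma oscillation_ub k x t : Xi x -> Theta t -> (ball t0 k.+1%:R^-1)° t ->
  `|ell x t - ell x t0| <= oscillation k x.
Proof.
move=> Xx Tt bt; apply: sup_upper_bound; first exact: osc_sup.
by exists t.
Qed.

Lemma oscillation_ge0 k x : Xi x -> 0 <= oscillation k x.
Proof.
move=> Xx; apply: le_trans (oscillation_ub (k := k) Xx Tt0 _) => //.
Qed.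

Lemma oscillation_le k x : Xi x -> oscillation k x <= 2 * g x.
Proof.
move=> Xx; apply: ge_sup; first by case: (osc_sup k Xx).
by move=> _ [t [Tt _] <-]; exact: osc_le.
Qed.

Lemma measurable_oscillation k : measurable_fun Xi (oscillation k).
Proof.
have [I [c [cT cD]]] := countable_dense_subset_rV Theta.
apply: (measurability _ (RGenOInfty.measurableE R)) => //=.
move=> _ [_ [a ->] <-].
rewrite (_ : Xi `&` _ = \bigcup_i (if c i is Some t then
   if t \in ((ball t0 k.+1%:R^-1)° : set 'rV[R]_s) then
     Xi `&` (fun x => `|ell x t - ell x t0|) @^-1` `]a, +oo[ else set0 else set0)).
  apply: countable_bigcupT_measurable => // i.
  case ci : (c i) => [t|] //; case: ifPn => // _.
  have Tt := cT _ _ ci.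
  have mf : measurable_fun Xi (fun x => `|ell x t - ell x t0|).
    by apply: measurableT_comp => //; apply: measurable_funB; exact: mell.
  exact: mf.
apply/seteqP; split => [x [Xx /=]|x [i _]].
  rewrite in_itv/= andbT => /(sup_gt (osc_sup k Xx).1)[_ [t [Tt bt] <-]] at'.
  have : \forall t' \near within Theta (nbhs t), a < `|ell x t' - ell x t0|.
    have /subspace_continuousP/(_ t Tt) cx := ell_continuous Xx.
    have : `|ell x t' - ell x t0| @[t' --> within Theta (nbhs t)] -->
        `|ell x t - ell x t0|.
      by apply: cvg_norm; apply: cvgB => //; exact: cvg_cst.
    by move=> /cvgr_gt; exact.
  rewrite near_withinE => nb.
  have [] := cD ((fun t' => Theta t' -> a < `|ell x t' - ell x t0|)° `&`
    (ball t0 k.+1%:R^-1)°) _ t Tt (conj nb bt).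
    by apply: openI; exact: open_interior.
  move=> i [u cu [/interior_subset au bu]].
  exists i => //; rewrite cu mem_set//; split => //=.
  by rewrite in_itv/= andbT; apply: au; exact: cT cu.
case ci : (c i) => [t|] //; case: ifPn => // /set_mem bt [Xx /=].
rewrite in_itv/= andbT => at'; split => //=; rewrite in_itv/= andbT.
by apply: (lt_le_trans at'); apply: oscillation_ub => //; exact: cT ci.
Qed.

Lemma cvg_oscillation x : Xi x -> oscillation^~ x @ \oo --> (0 : R).
Proof.
move=> Xx; apply/cvgrPdist_le => e e0.
have /subspace_continuousP/(_ t0 Tt0) cx := ell_continuous Xx.
have : \forall t' \near within Theta (nbhs t0), ball (ell x t0) e (ell x t').
  exact: cx _ (nbhsx_ballx (ell x t0) e e0).
rewrite near_withinE => /nbhs_ballP[r /= r0 rP].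
near=> k.
rewrite sub0r normrN ger0_norm ?oscillation_ge0//.
apply: ge_sup; first by case: (osc_sup k Xx).
move=> _ [t [Tt bt] <-]; rewrite distrC; apply/ltW.
apply: (rP t _ Tt); apply: le_ball (interior_subset bt).
by apply/ltW; near: k; exact: (near_infty_natSinv_lt (PosNum r0)).
Unshelve. all: by end_near.
Qed.

(** Dominated convergence: the oscillation tends to 0 pointwise by continuity and
is at most [2 * g]. *)
Lemma cvg_integral_oscillation (mu : {measure set 'rV[R]_d -> \bar R})
    (a : 'rV[R]_d -> R) :
  measurable_fun Xi g -> measurable_fun Xi a -> (forall x, Xi x -> 0 <= a x) ->
  (\int[mu]_(x in Xi) (`|g x| * a x)%:E < +oo)%E ->
  (\int[mu]_(x in Xi) (oscillation k x * a x)%:E)%E @[k --> \oo] --> 0%E.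
Proof.
move=> mg ma a0 ga.
have [] := @dominated_convergence _ _ _ mu Xi mXi
  (fun k x => (oscillation k x * a x)%:E) (cst 0%E) (fun x => (2 * (`|g x| * a x))%:E).
- move=> k; apply/measurable_EFinP/measurable_funM => //.
  exact: measurable_oscillation.
- exact: measurable_cst.
- apply: aeW => x Xx; apply: cvg_EFin; first by near=> k.
  rewrite -[X in _ --> X](mul0r (a x)); apply: cvgMl.
  exact: cvg_oscillation.
- under eq_fun do rewrite EFinM; apply: integrableZl => //.
  apply/integrableP; split.
    apply/measurable_EFinP/measurable_funM => //.
    exact: measurableT_comp.
  rewrite (eq_integral (fun x => (`|g x| * a x)%:E))//.
  by move=> x /[!inE] Xx; rewrite abse_EFin ger0_norm// mulr_ge0// a0.
- apply: aeW => x k Xx; rewrite abse_EFin lee_fin.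
  rewrite ger0_norm ?mulr_ge0 ?oscillation_ge0 ?a0//.
  rewrite mulrA ler_wpM2r ?a0//.
  by apply: (le_trans (oscillation_le k Xx)); rewrite ler_wpM2l// ler_norm.
by move=> _ _; rewrite integral0.
Unshelve. all: by end_near.
Qed.

Lemma integral_oscillation_small (mu : {measure set 'rV[R]_d -> \bar R})
    (a : 'rV[R]_d -> R) e :
  measurable_fun Xi g -> measurable_fun Xi a -> (forall x, Xi x -> 0 <= a x) ->
  (\int[mu]_(x in Xi) (`|g x| * a x)%:E < +oo)%E -> 0 < e ->
  \forall k \near \oo, (\int[mu]_(x in Xi) (oscillation k x * a x)%:E <= e%:E)%E.
Proof.
move=> mg ma a0 ga e0.
have /fine_cvgP[Wfin /cvgr_lt Wlt] := cvg_integral_oscillation mg ma a0 ga.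
apply: filterS2 Wfin (Wlt e e0) => k kfin klt.
by rewrite -(fineK kfin) lee_fin ltW.
Qed.

End local_oscillation.

Section uniform_law.
Context (R : realType) (H : finType) (d s : nat) (Xi : set 'rV[R]_d).
Context (varpi : H -> H -> R) (q : 'rV[R]_d -> H -> R).
Context (disp : measure_display) (Omega : measurableType disp).
Context (P : probability Omega R) (eta1 : H).
Context (xi : nat -> Omega -> 'rV[R]_d) (eta : nat -> Omega -> H).
Context (Xi_closed : closed Xi) (q_density : forall h, is_density Xi (q^~ h)).
Context (data : data_process Xi varpi q P eta1 xi eta).
Context (Theta : set 'rV[R]_s).
Context (ell : 'rV[R]_d -> H -> 'rV[R]_s -> R) (g : 'rV[R]_d -> H -> R).
Context (mell : forall h t, Theta t -> measurable_fun Xi (fun x => ell x h t)).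
Context (ell_continuous : forall x h, Xi x -> {within Theta, continuous (ell x h)}).
Context (mg : forall h, measurable_fun Xi (g^~ h)).
Context (g_integrable : forall h,
  (\int[lebesgue_rV R d]_(x in Xi) (`|g x h| * q x h)%:E < +oo)%E).
Context (ell_g : forall x h t, Xi x -> Theta t -> `|ell x h t| <= g x h).

(** The summands are bounded by an oscillation whose conditional mean is small on a
small neighbourhood, which is the situation of [ae_eventually_sum_le]. *)
Lemma ae_local_uniform_law t0 kappa : Theta t0 -> 0 < kappa ->
  exists2 B, nbhs t0 B & {ae P, forall w, \forall N \near \oo,
    forall t, Theta t -> B t ->
    \sum_(i < N) `|ell (xi i w) (eta i w) t - ell (xi i w) (eta i w) t0| <=
    kappa * N%:R}.
Proof.
move=> Tt0 kappa0.
have mXi := closed_measurable_rV Xi_closed.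
pose W k x h := oscillation Theta (fun x t => ell x h t) t0 k x.
have W0 k x h : Xi x -> 0 <= W k x h.
  by move=> Xx; exact: (oscillation_ge0 (fun x t => @ell_g x h t)).
have mW k h : measurable_fun Xi ((W k)^~ h).
  exact: (measurable_oscillation mXi (@mell h) (fun x => @ell_continuous x h)
    (fun x t => @ell_g x h t)).
have q0 h x : Xi x -> 0 <= q x h by case: (q_density h) => _ + _; exact.
have mq h : measurable_fun Xi (q^~ h) by case: (q_density h).
have : \forall k \near \oo, forall h,
    (\int[lebesgue_rV R d]_(x in Xi) (W k x h * q x h)%:E <= (kappa / 4)%:E)%E.
  apply: filter_forall => h.
  apply: (@integral_oscillation_small _ _ _ Xi Theta (fun x t => ell x h t)
    (g^~ h)) => //; do ?[by move=> x; exact: q0]; last by rewrite divr_gt0.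
  - by move=> t Tt; exact: mell.
  - by move=> x; exact: ell_continuous.
  - by move=> x t; exact: ell_g.
case=> k _ /(_ k (leqnn _)) Wk.
exists (ball t0 k.+1%:R^-1)°.
  by apply/nbhs_interior; apply: nbhsx_ballx; rewrite invr_gt0.
apply: filterS (ae_eventually_sum_le Xi_closed q_density data (mW k) (W0 k) _ Wk).
  move=> w; apply: filterS => N.
  rewrite [4 * _]mulrC divfK// => sW t Tt bt; apply: le_trans sW.
  apply: ler_sum => i _.
  have Xx := xi_in_Xi data i w.
  exact: (oscillation_ub (fun x t => @ell_g x (eta i w) t) Tt0 Xx Tt bt).
by rewrite divr_gt0.
Qed.

End uniform_law.

(** * Continuity of the densities in L1 *)

Lemma measurable_fun_within_continuous (R : realType) n (A : set 'rV[R]_n)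
    (g : 'rV[R]_n -> R) :
  measurable A -> {within A, continuous g} -> measurable_fun A g.
Proof.
move=> mA /subspace_continuousP cg.
apply: (measurability _ (RGenOInfty.measurableE R)) => //=.
move=> _ [_ [a ->] <-].
rewrite (_ : A `&` _ = A `&` ((fun t => A t -> a < g t) : set 'rV[R]_n)°).
  by apply: measurableI => //; apply: open_measurable_rV; exact: open_interior.
apply/seteqP; split => t [At /=].
  rewrite in_itv/= andbT => agt; split => //.
  have : \forall t' \near within A (nbhs t), a < g t'.
    by move/cvgr_gt : (cg t At); exact.
  by rewrite near_withinE.
by move=> /interior_subset/(_ At) agt; split => //=; rewrite in_itv/= andbT.
Qed.

Lemma within_continuous_comp (R : realType) n (A : set 'rV[R]_n)
    (g : 'rV[R]_n -> R) (k : R -> R) :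
  {within A, continuous g} -> (forall t, A t -> {for g t, continuous k}) ->
  {within A, continuous (k \o g)}.
Proof.
move=> /subspace_continuousP cg ck; apply/subspace_continuousP => t At.
by apply: (cvg_comp _ _ (cg t At)); exact: ck.
Qed.

Section density_family.
Context (R : realType) (d s : nat) (Xi : set 'rV[R]_d) (Theta : set 'rV[R]_s).
Context (f : 'rV[R]_d -> 'rV[R]_s -> R).
Context (mXi : measurable Xi).
Context (f_density : forall t, Theta t -> is_density Xi (f^~ t)).
Context (f_continuous : forall x, Xi x -> {within Theta, continuous (f x)}).

Local Notation mu := (lebesgue_rV R d).

Definition L1_dist t t' := \int[mu]_(x in Xi) `|f x t - f x t'|.

Let mf t : Theta t -> measurable_fun Xi (f^~ t).
Proof. by case/f_density. Qed.

Let f0 t x : Theta t -> Xi x -> 0 <= f x t.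
Proof. by move=> /f_density[_ + _]; exact. Qed.

Lemma density_integrable t : Theta t -> mu.-integrable Xi (fun x => (f x t)%:E).
Proof. by move=> Tt; exact: is_density_integrable (f_density Tt). Qed.

Lemma dist_integrable t t' : Theta t -> Theta t' ->
  mu.-integrable Xi (fun x => `|f x t - f x t'|%:E).
Proof.
move=> Tt Tt'.
have i : mu.-integrable Xi (fun x => (f x t - f x t')%:E).
  under eq_fun do rewrite EFinB.
  by apply: integrableB => //; exact: density_integrable.
exact: (integrable_norm i).
Qed.

Lemma L1_dist_ge0 t t' : 0 <= L1_dist t t'.
Proof. exact: Rintegral_ge0. Qed.

Lemma Rintegral_density t : Theta t -> \int[mu]_(x in Xi) f x t = 1.
Proof. by move=> /f_density[_ _]; rewrite /Rintegral => ->. Qed.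

Lemma L1_dist_le2 t t' : Theta t -> Theta t' -> L1_dist t t' <= 2.
Proof.
move=> Tt Tt'.
have iD : mu.-integrable Xi (fun x => (f x t + f x t')%:E).
  under eq_fun do rewrite EFinD.
  by apply: integrableD => //; exact: density_integrable.
have -> : (2 : R) = \int[mu]_(x in Xi) (f x t + f x t').
  rewrite RintegralD//; do ?exact: density_integrable.
  by rewrite !Rintegral_density.
apply: le_Rintegral => //; first exact: dist_integrable.
by move=> x Xx; rewrite (le_trans (ler_normB _ _))// !ger0_norm// f0.
Qed.

Lemma L1_dist_triangle t t' u : Theta t -> Theta t' -> Theta u ->
  L1_dist t u <= L1_dist t t' + L1_dist t' u.
Proof.
move=> Tt Tt' Tu.
have iD : mu.-integrable Xi (fun x => (`|f x t - f x t'| + `|f x t' - f x u|)%:E).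
  under eq_fun do rewrite EFinD.
  by apply: integrableD => //; exact: dist_integrable.
rewrite -RintegralD//; do ?exact: dist_integrable.
apply: le_Rintegral => //; first exact: dist_integrable.
by move=> x Xx; exact: ler_distD.
Qed.

(** Scheffe's lemma: pointwise continuity of a family of probability densities
gives continuity in L1.  Since both densities have mass 1, the distance is twice
the integral of [f x t0 - Num.min (f x t) (f x t0)], and this is dominated by
[f x t0]; so the oscillation of [Num.min (f x t) (f x t0)] controls it. *)
Lemma L1_dist_small t0 e : Theta t0 -> 0 < e ->
  exists2 B, nbhs t0 B & forall t, Theta t -> B t -> L1_dist t t0 <= e.
Proof.
move=> Tt0 e0.
pose ell x t := Num.min (f x t) (f x t0).
have mell t : Theta t -> measurable_fun Xi (ell^~ t).
  by move=> Tt; apply: measurable_minr; exact: mf.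
have cell x : Xi x -> {within Theta, continuous (ell x)}.
  move=> Xx; apply: (@within_continuous_comp _ _ _ (f x) (fun y => Num.min y (f x t0))).
    exact: f_continuous.
  move=> t _; apply: continuous_min; first exact: cvg_id.
  exact: cvg_cst.
have ellf x t : Xi x -> Theta t -> `|ell x t| <= f x t0.
  by move=> Xx Tt; rewrite ger0_norm ?le_min ?f0// ge_min lexx orbT.
have [_ _ f1] := f_density Tt0.
have : \forall k \near \oo, (\int[mu]_(x in Xi)
    (oscillation Theta ell t0 k x * 1)%:E <= (e / 2)%:E)%E.
  apply: (@integral_oscillation_small _ _ _ Xi Theta ell (f^~ t0)) => //.
  - exact: mf.
  - rewrite (eq_integral (fun x => (f x t0)%:E)) ?f1 ?ltry// => x /[!inE] Xx.
    by rewrite mulr1 ger0_norm// f0.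
  - by rewrite divr_gt0.
case=> k _ /(_ k (leqnn _)) /= ke.
exists (ball t0 k.+1%:R^-1)°.
  by apply/nbhs_interior; apply: nbhsx_ballx; rewrite invr_gt0.
move=> t Tt Bt.
have iell : mu.-integrable Xi (fun x => (ell x t)%:E).
  apply: le_integrable (density_integrable Tt0) => //.
    by apply/measurable_EFinP; exact: mell.
  move=> x Xx; rewrite !abse_EFin lee_fin [leRHS]ger0_norm ?f0//.
  exact: ellf.
have i1 : mu.-integrable Xi (fun x => (f x t0 - ell x t)%:E).
  by under eq_fun do rewrite EFinB; apply: integrableB => //; exact: density_integrable.
have i2 : mu.-integrable Xi (fun x => (2 * (f x t0 - ell x t))%:E).
  by under eq_fun do rewrite EFinM; exact: integrableZl.
have i3 : mu.-integrable Xi (fun x => (f x t - f x t0)%:E).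
  by under eq_fun do rewrite EFinB; apply: integrableB => //; exact: density_integrable.
have -> : L1_dist t t0 = \int[mu]_(x in Xi) (2 * (f x t0 - ell x t)).
  have -> : L1_dist t t0 = \int[mu]_(x in Xi)
     ((f x t - f x t0) + 2 * (f x t0 - ell x t)).
    apply: eq_Rintegral => x _; rewrite /ell.
    case: (leP (f x t) (f x t0)) => h.
      by rewrite ler0_norm ?subr_le0//; lra.
    by rewrite ger0_norm ?subr_ge0 1?ltW//; lra.
  rewrite RintegralD//.
  rewrite RintegralB//; do ?exact: density_integrable.
  by rewrite !Rintegral_density// subrr add0r.
rewrite RintegralZl// mulrC -ler_pdivlMr//.
rewrite -lee_fin /Rintegral fineK; last exact: integrable_fin_num.
apply: le_trans ke; apply: ge0_le_integral => //.
- by move=> x Xx; rewrite lee_fin subr_ge0 ge_min lexx orbT.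
- exact: measurable_int i1.
- apply/measurable_EFinP; apply: measurable_funM => //.
  exact: (measurable_oscillation mXi mell cell ellf).
- move=> x Xx; rewrite lee_fin mulr1.
  have /= := oscillation_ub ellf Tt0 Xx Tt Bt.
  apply: le_trans; rewrite distrC.
  rewrite {2}/ell; apply: le_trans (ler_norm _).
  by rewrite minxx.
Qed.

Lemma integral_mul_density_dist (Y : 'rV[R]_d -> R) (M : R) t t' :
  measurable_fun Xi Y -> (forall x, Xi x -> `|Y x| <= M) ->
  Theta t -> Theta t' ->
  `|\int[mu]_(x in Xi) (Y x * f x t) - \int[mu]_(x in Xi) (Y x * f x t')| <=
  M * L1_dist t t'.
Proof.
move=> mY YM Tt Tt'.
have iY u : Theta u -> mu.-integrable Xi (fun x => (Y x * f x u)%:E).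
  by move=> Tu; apply: (bounded_mul_integrable mXi mY YM); exact: density_integrable.
rewrite -RintegralB//; do ?exact: iY.
have iB : mu.-integrable Xi (fun x => (Y x * f x t - Y x * f x t')%:E).
  by under eq_fun do rewrite EFinB; apply: integrableB => //; exact: iY.
apply: (le_trans (le_normr_Rintegral mXi iB)).
have iZ : mu.-integrable Xi (fun x => (M * `|f x t - f x t'|)%:E).
  under eq_fun do rewrite EFinM.
  by apply: integrableZl => //; exact: dist_integrable.
rewrite /L1_dist -RintegralZl//; last exact: dist_integrable.
apply: le_Rintegral => //.
  exact: (integrable_norm iB).
by move=> x Xx; rewrite -mulrBr normrM ler_wpM2r// YM.
Qed.

Lemma integral_mul_density_continuous (Y : 'rV[R]_d -> R) (M : R) :
  measurable_fun Xi Y -> (forall x, Xi x -> `|Y x| <= M) ->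
  {within Theta, continuous (fun t => \int[mu]_(x in Xi) (Y x * f x t))}.
Proof.
move=> mY YM; apply/subspace_continuousP => t0 Tt0.
apply/cvgrPdist_le => e e0; rewrite near_withinE.
pose M' := Num.max M 1.
have M'0 : 0 < M' by rewrite lt_max ltr01 orbT.
have [B nB BP] := L1_dist_small Tt0 (divr_gt0 e0 M'0).
apply: filterS nB => t Bt Tt; rewrite distrC.
apply: (le_trans (integral_mul_density_dist mY YM Tt Tt0)).
apply: (@le_trans _ _ (M' * L1_dist t t0)).
  by rewrite ler_wpM2r ?L1_dist_ge0// le_max lexx.
by rewrite mulrC -ler_pdivlMr// BP.
Qed.

End density_family.

(** * Concentration of the likelihood *)

Section consistency.
Context (R : realType) (H : finType) (d s : nat) (Xi : set 'rV[R]_d).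
Context (varpi : H -> H -> R) (q : 'rV[R]_d -> H -> R).
Context (disp : measure_display) (Omega : measurableType disp).
Context (P : probability Omega R) (eta1 : H).
Context (xi : nat -> Omega -> 'rV[R]_d) (eta : nat -> Omega -> H).
Context (Xi_closed : closed Xi) (q_density : forall h, is_density Xi (q^~ h)).
Context (varpi_stochastic : stochastic varpi).
Context (varpi_irreducible : irreducible_chain varpi).
Context (data : data_process Xi varpi q P eta1 xi eta).
Context (Theta : set 'rV[R]_s) (f : 'rV[R]_d -> H -> 'rV[R]_s -> R).
Context (f_density : forall h t, Theta t -> is_density Xi (fun x => f x h t)).
Context (Theta_compact : compact Theta).
Context (f_gt0 : forall x h t, Xi x -> Theta t -> 0 < f x h t).
Context (f_continuous : forall x h, Xi x -> {within Theta, continuous (f x h)}).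
Context (g : 'rV[R]_d -> H -> R) (mg : forall h, measurable_fun Xi (g^~ h)).
Context (g_integrable : forall h,
  (\int[lebesgue_rV R d]_(x in Xi) (`|g x h| * q x h)%:E < +oo)%E).
Context (ln_g : forall x h t, Xi x -> Theta t -> `|ln (f x h t)| <= g x h).
Context (ts : 'rV[R]_s) (Tts : Theta ts).
Context (well_specified : forall h x, Xi x -> q x h = f x h ts).

Let mXi : measurable Xi := closed_measurable_rV Xi_closed.

(** Concentration is expressed through this distance between observation laws
instead of the distance between parameters: it is what controls predictive
expectations. *)
Definition model_dist t := \sum_h L1_dist Xi (fun x => f x h) t ts.

Definition log_ratio (xs : nat -> 'rV[R]_d) (hs : nat -> H) N t :=
  \sum_(i < N) (ln (f (xs i) (hs i) t) - ln (f (xs i) (hs i) ts)).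

Let ell x h t := ln (f x h t).

Lemma ln_density_continuous x h : Xi x ->
  {within Theta, continuous (fun t => ln (f x h t))}.
Proof.
move=> Xx; apply: (@within_continuous_comp _ _ _ (f x h) (@ln R)).
  exact: f_continuous.
by move=> t Tt; apply: continuous_ln; exact: f_gt0.
Qed.

Let mell h t : Theta t -> measurable_fun Xi (fun x => ell x h t).
Proof.
by move=> /(f_density h)[mf _ _]; exact: measurableT_comp.
Qed.

Let local_law t0 kappa : Theta t0 -> 0 < kappa ->
  exists2 B, nbhs t0 B & {ae P, forall w, \forall N \near \oo,
    forall t, Theta t -> B t ->
    \sum_(i < N) `|ell (xi i w) (eta i w) t - ell (xi i w) (eta i w) t0| <=
    kappa * N%:R}.
Proof.
exact: (ae_local_uniform_law Xi_closed q_density data mell ln_density_continuous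
  mg g_integrable ln_g).
Qed.

Lemma ae_log_ratio_ge kappa : 0 < kappa ->
  exists2 B, nbhs ts B & {ae P, forall w, \forall N \near \oo,
    forall t, Theta t -> B t ->
    - kappa * N%:R <= log_ratio (xi^~ w) (eta^~ w) N t}.
Proof.
move=> k0; have [B nB Bk] := local_law Tts k0; exists B => //.
apply: filterS Bk => w; apply: filterS => N h t Tt Bt.
rewrite mulNr lerNl /log_ratio -sumrN; apply: le_trans (h t Tt Bt).
by apply: ler_sum => i _; rewrite (le_trans (ler_norm _))// normrN.
Qed.

Lemma model_dist_small t0 e : Theta t0 -> model_dist t0 < e ->
  \forall t \near t0, Theta t -> model_dist t < e.
Proof.
move=> Tt0 De.
have e0 : 0 < (e - model_dist t0) / #|H|.+1%:R by rewrite divr_gt0// subr_gt0.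
have : forall h, \forall t \near t0, Theta t ->
    L1_dist Xi (fun x => f x h) t t0 <= (e - model_dist t0) / #|H|.+1%:R.
  move=> h; have [B nB BP] := L1_dist_small mXi (f_density h)
    (fun x => @f_continuous x h) Tt0 e0.
  by apply: filterS nB => t Bt Tt; exact: BP.
move=> /filter_forall; apply: filterS => t ht Tt.
apply: (@le_lt_trans _ _ (\sum_h ((e - model_dist t0) / #|H|.+1%:R +
    L1_dist Xi (fun x => f x h) t0 ts))).
  apply: ler_sum => h _.
  apply: (le_trans (L1_dist_triangle mXi (f_density h) Tt Tt0 Tts)).
  by rewrite lerD2r ht.
rewrite big_split /= -/(model_dist t0) -ltrBrDr sumr_const -[_ *+ #|_|]mulr_natr.
rewrite mulrAC ltr_pdivrMr// ltr_pM2l ?subr_gt0// ltr_nat.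
by rewrite cardT.
Qed.

Lemma ae_log_ratio_decay t1 : Theta t1 -> 0 < model_dist t1 ->
  exists2 a : R, 0 < a & {ae P, forall w, \forall N \near \oo,
    log_ratio (xi^~ w) (eta^~ w) N t1 <= - a * N%:R}.
Proof.
move=> Tt1 D0.
have : \sum_h L1_dist Xi (fun x => f x h) t1 ts <> 0 by apply/eqP; rewrite gt_eqF.
move=> /psumr_neq0P[h _|h0 /= Lh0]; first exact: L1_dist_ge0.
have q_gt0 x h : Xi x -> 0 < q x h by move=> Xx; rewrite well_specified// f_gt0.
have [] := @ae_log_likelihood_ratio_decay _ _ _ Xi varpi q _ _ P eta1 xi eta
  Xi_closed q_density varpi_stochastic varpi_irreducible data
  (fun x h => f x h t1) h0 q_gt0 (fun x h Xx => f_gt0 h Xx Tt1)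
  (fun h => f_density h Tt1).
  apply/eqP => I0; move: Lh0; rewrite /L1_dist /Rintegral.
  rewrite [X in fine X](_ : _ = 0%E) ?ltxx//.
  rewrite -[RHS]I0; apply: eq_integral => x /[!inE] Xx.
  by rewrite well_specified.
move=> a a0 ha; exists a => //; apply: filterS ha => w; apply: filterS => N.
move=> /(le_trans _); apply; rewrite le_eqVlt; apply/orP; left; apply/eqP.
by apply: eq_bigr => i _; rewrite well_specified//; exact: (xi_in_Xi data).
Qed.

(* Along this filter, eventually means: for all small rates, almost surely, for
   all large sample sizes.  It allows compactness of [Theta] to be applied to
   almost sure asymptotic statements with a rate depending on the point. *)
Let F : set_system (R * (Omega * nat)) := fun A =>
  \forall k \near 0^'+, {ae P, forall w, \forall N \near \oo, A (k, (w, N))}.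

Let F_filter : Filter F.
Proof.
split; rewrite /F.
- by near=> k; apply: aeW => w; near=> N.
- move=> A B FA FB; apply: filterS2 FA FB => k; apply: filterS2 => w.
  by apply: filterS2 => N.
- move=> A B AB; apply: filterS => k; apply: filterS => w; apply: filterS => N.
  exact: AB.
Unshelve. all: by end_near.
Qed.

(** Each [t1] has a neighbourhood on which either the model distance stays below
[e], or the decay at [t1] survives, with half its rate, thanks to the local
uniform law.  Compactness makes the rate and the sample size uniform. *)
Lemma ae_uniform_log_ratio_decay e : 0 < e ->
  exists2 k : R, 0 < k & {ae P, forall w, \forall N \near \oo,
    forall t, Theta t ->
    model_dist t < e \/ log_ratio (xi^~ w) (eta^~ w) N t <= - k * N%:R}.
Proof.
move=> e0.
pose good (z : R * (Omega * nat)) t := model_dist t < e \/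
  log_ratio (xi^~ z.2.1) (eta^~ z.2.1) z.2.2 t <= - z.1 * z.2.2%:R.
have : \forall z \near F, Theta `<=` good z.
  have := Theta_compact; rewrite compact_near_coveringP.
  move=> /near_covering_withinP/(_ _ F good F_filter); apply => t1 Tt1.
  have [De|eD] := ltP (model_dist t1) e.
    exists ((fun t => Theta t -> model_dist t < e), setT) => /=.
      by split; [exact: model_dist_small|exact: (@filterT _ F F_filter)].
    by move=> [t z] [/= h _] Tt; left; exact: h.
  have [a a0 ha] := ae_log_ratio_decay Tt1 (lt_le_trans e0 eD).
  have [B nB hB] := local_law Tt1 (divr_gt0 a0 (ltr0n R 2)).
  have FS : F [set z | forall t, Theta t -> B t -> good z t].
    rewrite /F; near=> k.
    apply: filterS2 ha hB => w; apply: filterS2 => N h1 h2 t Tt Bt; right => /=.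
    have {}h2 := h2 t Tt Bt.
    have -> : log_ratio (xi^~ w) (eta^~ w) N t =
        log_ratio (xi^~ w) (eta^~ w) N t1 +
        \sum_(i < N) (ell (xi i w) (eta i w) t - ell (xi i w) (eta i w) t1).
      by rewrite -big_split /=; apply: eq_bigr => i _; rewrite /ell; ring.
    apply: (@le_trans _ _ (- a * N%:R + a / 2 * N%:R)).
      apply: lerD h1 _; apply: le_trans h2.
      by apply: ler_sum => i _; exact: ler_norm.
    have ka : k <= a / 2 by near: k; apply: nbhs_right_le; rewrite divr_gt0.
    by rewrite -mulrDl ler_wpM2r//; lra.
  exists (B, [set z | forall t, Theta t -> B t -> good z t]) => //=.
  by move=> [t z] [/= Bt h] Tt; exact: h.
rewrite /F => FG.
have [k /andP[k0 Gk]] : exists k, (0 < k) && `[< {ae P, forall w, \forall N \near \oo,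
    Theta `<=` good (k, (w, N))} >].
  near (0 : R)^'+ => k; exists k; apply/andP; split; first by near: k; exact: nbhs_right_gt.
  by apply/asboolP; near: k.
by exists k => //; move/asboolP : Gk.
Unshelve. all: by end_near.
Qed.

End consistency.

(** * Posterior expectations *)

Lemma nbhs_rV_pos_measure (R : realType) n (t : 'rV[R]_n) (B : set 'rV[R]_n) :
  nbhs t B -> exists A, [/\ measurable A, A `<=` B,
    (0 < lebesgue_rV R n A)%E & (lebesgue_rV R n A < +oo)%E].
Proof.
move=> /nbhs_ballP[e /= e0 eB].
pose itv i : set R := `](t ord0 i - e), (t ord0 i + e)[%classic.
pose Bx : set 'rV[R]_n := [set v | forall i, itv i (v ord0 i)]; exists Bx.
have mI i : measurable (itv i) by exact: measurable_itv.
have muI i : lebesgue_measure (itv i) = (2 * e)%:E.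
  rewrite /itv lebesgue_measure_itv/= lte_fin ifT; last by lra.
  by rewrite -EFinB; congr EFin; ring.
have prodE : (\prod_(i < n) lebesgue_measure (itv i) = ((2 * e) ^+ n)%:E)%E.
  under eq_bigr do rewrite muI.
  by rewrite prodEFin prodr_const card_ord.
split.
- rewrite (_ : Bx = \bigcap_i ((fun v : 'rV[R]_n => v ord0 i) @^-1` itv i)).
    apply: fin_bigcap_measurable => // i _.
    by rewrite -[X in measurable X]setTI; exact: measurable_coord_rV.
  by apply/seteqP; split => [v h i _|v h i]; [exact: h|exact: (h i Logic.I)].
- move=> v h; apply: eB; split => // i j; rewrite ord1.
  have := h j; rewrite /itv /= in_itv/= => /andP[h1 h2].
  by rewrite /ball/= ltr_norml; apply/andP; split; lra.
- by rewrite lebesgue_rV_prod// prodE lte_fin exprn_gt0// mulr_gt0.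
- by rewrite lebesgue_rV_prod// prodE ltry.
Qed.

Section posterior_bound.
Context (R : realType) (H : finType) (d s : nat) (Xi : set 'rV[R]_d).
Context (varpi : H -> H -> R) (q : 'rV[R]_d -> H -> R).
Context (Theta : set 'rV[R]_s) (f : 'rV[R]_d -> H -> 'rV[R]_s -> R).
Context (p : 'rV[R]_s -> R) (c2 : R) (g : 'rV[R]_d -> H -> R).
Context (mXi : measurable Xi) (mTheta : measurable Theta).
Context (f_density : forall h t, Theta t -> is_density Xi (fun x => f x h t)).
Context (p_density : is_density Theta p).
Context (c2_gt0 : 0 < c2) (p_ge : forall t, Theta t -> c2 <= p t).
Context (f_gt0 : forall x h t, Xi x -> Theta t -> 0 < f x h t).
Context (f_continuous : forall x h, Xi x -> {within Theta, continuous (f x h)}).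
Context (ln_g : forall x h t, Xi x -> Theta t -> `|ln (f x h t)| <= g x h).
Context (ts : 'rV[R]_s) (Tts : Theta ts).
Context (well_specified : forall h x, Xi x -> q x h = f x h ts).

Context (xs : nat -> 'rV[R]_d) (hs : nat -> H) (Xxs : forall i, Xi (xs i)).
Context (hs_path : forall i, 0 < varpi (hs i) (hs i.+1)).

Local Notation muT := (lebesgue_rV R s).
Local Notation muX := (lebesgue_rV R d).

Let L N t := expR (log_ratio f ts xs hs N t).

Let p0 t : Theta t -> 0 < p t. Proof. by move=> /p_ge; exact: lt_le_trans. Qed.

Lemma likelihood_log_ratio N : (0 < N)%N -> exists2 C, 0 < C &
  forall t, Theta t ->
  likelihood varpi f N xs hs t = C * expR (log_ratio f ts xs hs N t).
Proof.
move=> N0; exists (\prod_(i < N) f (xs i) (hs i) ts *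
   \prod_(1 <= i < N) varpi (hs i.-1) (hs i)).
  rewrite mulr_gt0//; first by apply: prodr_gt0 => i _; exact: f_gt0.
  rewrite big_nat_cond; apply: prodr_gt0 => i /andP[/andP[i0 _] _].
  by rewrite -{2}(prednK i0).
move=> t Tt; rewrite /likelihood big_split /= mulrA [RHS]mulrAC; congr (_ * _).
have -> : f (xs 0) (hs 0) t * \prod_(1 <= i < N) f (xs i) (hs i) t =
    \prod_(i < N) f (xs i) (hs i) t.
  by rewrite -[RHS](big_mkord xpredT (fun i => f (xs i) (hs i) t)) [RHS]big_ltn.
rewrite /log_ratio expR_sum -big_split /=; apply: eq_bigr => i _.
by rewrite expRB !lnK ?posrE ?f_gt0// mulrC divfK// gt_eqF// f_gt0.
Qed.

Let mL N : measurable_fun Theta (L N).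
Proof.
apply: measurableT_comp => //; apply: measurable_sum => i.
apply: measurable_funB => //.
apply: measurable_fun_within_continuous => //.
exact: (ln_density_continuous f_gt0 f_continuous).
Qed.

Let L_le N t : Theta t -> L N t <= expR (\sum_(i < N) 2 * g (xs i) (hs i)).
Proof.
move=> Tt; rewrite ler_expR; apply: ler_sum => i _.
apply: (le_trans (ler_norm _)); apply: (le_trans (ler_normB _ _)).
have := ln_g (hs i) (Xxs i) Tt; have := ln_g (hs i) (Xxs i) Tts; lra.
Qed.



Let ip : muT.-integrable Theta (fun t => (p t)%:E).
Proof. exact: is_density_integrable p_density. Qed.

Let iLp N : muT.-integrable Theta (fun t => (L N t * p t)%:E).
Proof.
apply: (bounded_mul_integrable mTheta (mL N) _ ip) => t Tt.
by rewrite ger0_norm ?expR_ge0//; exact: L_le.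
Qed.

Let Z N := \int[muT]_(t in Theta) (L N t * p t).

(** The common factor, which contains the transition probabilities, cancels. *)
Lemma posterior_log_ratio N t : (0 < N)%N -> Theta t ->
  posterior Theta varpi f p N xs hs t = L N t * p t / Z N.
Proof.
move=> N0 Tt; have [C C0 CL] := likelihood_log_ratio N0.
rewrite /posterior CL//.
rewrite (_ : \int[muT]_(t in Theta) _ = C * Z N).
  by rewrite invfM -[C * _ * _]mulrA mulrACA mulfV ?gt_eqF// mul1r.
rewrite -RintegralZl//; last exact: (iLp N).
apply: eq_Rintegral => u /[!inE] Tu.
by rewrite CL// mulrA.
Qed.

Context (N : nat) (N_gt0 : (0 < N)%N) (e k : R) (e_gt0 : 0 < e).
Context (A : set 'rV[R]_s) (mA : measurable A) (AT : A `<=` Theta).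
Context (A_gt0 : (0 < muT A)%E) (A_lty : (muT A < +oo)%E).
Context (L_far : forall t, Theta t ->
  model_dist Xi f ts t < e \/ log_ratio f ts xs hs N t <= - k * N%:R).
Context (L_near : forall t, A t -> - (k / 2) * N%:R <= log_ratio f ts xs hs N t).

Let post t := posterior Theta varpi f p N xs hs t.

Let v := fine (muT A).
Let v_gt0 : 0 < v. Proof. by rewrite fine_gt0// A_gt0 A_lty. Qed.

(* The evidence is at least what the parameters near [ts] contribute. *)
Let Z_ge : expR (- (k / 2) * N%:R) * c2 * v <= Z N.
Proof.
have vE : v%:E = muT A by rewrite fineK// ge0_fin_numE.
rewrite -lee_fin /Z /Rintegral fineK; last exact: integrable_fin_num (iLp N).
rewrite EFinM vE -integral_cst//.
apply: (@le_trans _ _ (\int[muT]_(t in A) (L N t * p t)%:E)%E).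
  apply: ge0_le_integral => //.
  - by move=> t At; rewrite lee_fin mulr_ge0 ?expR_ge0// ltW.
  - by apply: measurable_funS (measurable_int _ (iLp N)).
  - move=> t At; rewrite lee_fin; apply: ler_pM; rewrite ?expR_ge0 ?(ltW c2_gt0)//.
      by rewrite ler_expR L_near.
    by apply: p_ge; exact: AT.
apply: ge0_subset_integral => //; first exact: measurable_int (iLp N).
by move=> t Tt; rewrite lee_fin mulr_ge0 ?expR_ge0// ltW// p0.
Qed.

Let Z_gt0 : 0 < Z N.
Proof. by apply: lt_le_trans Z_ge; rewrite !mulr_gt0// expR_gt0. Qed.

Let postE t : Theta t -> post t = (Z N)^-1 * (L N t * p t).
Proof. by move=> Tt; rewrite /post posterior_log_ratio// mulrC. Qed.

Let post_ge0 t : Theta t -> 0 <= post t.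
Proof.
move=> Tt; rewrite postE// mulr_ge0 ?invr_ge0 ?(ltW Z_gt0)// mulr_ge0 ?expR_ge0//.
by rewrite ltW// p0.
Qed.

Let ipost : muT.-integrable Theta (fun t => (post t)%:E).
Proof.
apply: (@eq_integrable _ _ _ _ _ mTheta
  (fun t => ((Z N)^-1 * (L N t * p t))%:E)).
  by move=> t /[!inE] Tt; rewrite postE.
by under eq_fun do rewrite EFinM; exact: integrableZl.
Qed.

Let int_post : \int[muT]_(t in Theta) post t = 1.
Proof.
rewrite (@eq_Rintegral _ _ _ _ _ (fun t => (Z N)^-1 * (L N t * p t))).
  rewrite RintegralZl//; last exact: (iLp N).
  by apply: mulVf; rewrite gt_eqF.
by move=> t /[!inE] Tt; rewrite postE.
Qed.

Let D := model_dist Xi f ts.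

Let D_le t : Theta t -> D t <= 2 * #|H|%:R.
Proof.
move=> Tt; have -> : 2 * #|H|%:R = \sum_(h : H) (2 : R).
  by rewrite sumr_const -[_ *+ #|_|]mulr_natr cardT.
by apply: ler_sum => h _; exact: (L1_dist_le2 mXi (f_density h)).
Qed.

Let D_ge0 t : 0 <= D t.
Proof. by apply: sumr_ge0 => h _; exact: L1_dist_ge0. Qed.

(* Either the distance is small, or the likelihood ratio is; in the second case
   the density of the posterior is compared with that of the prior. *)
Let post_dist t : Theta t ->
  post t * D t <= e * post t + 2 * #|H|%:R * expR (- k * N%:R) / Z N * p t.
Proof.
move=> Tt; have Zi : 0 < (Z N)^-1 by rewrite invr_gt0.
have [De|far] := L_far Tt.
  apply: (@le_trans _ _ (e * post t)).
    by rewrite mulrC ler_wpM2r ?post_ge0// ltW.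
  by rewrite lerDl !mulr_ge0 ?expR_ge0 ?(ltW Zi) ?(ltW (p0 Tt)).
apply: (@le_trans _ _ (2 * #|H|%:R * expR (- k * N%:R) / Z N * p t)); last first.
  by rewrite lerDr mulr_ge0 ?post_ge0// ltW.
have -> : 2 * #|H|%:R * expR (- k * N%:R) / Z N * p t =
    (Z N)^-1 * (expR (- k * N%:R) * p t) * (2 * #|H|%:R) by ring.
apply: ler_pM; rewrite ?post_ge0 ?D_ge0 ?D_le// postE// ler_wpM2l ?(ltW Zi)//.
by rewrite ler_wpM2r ?(ltW (p0 Tt))// ler_expR.
Qed.

(** The first term accounts for replacing [Y] by [Y'], the second one for replacing
the posterior mixture by the true law.  The quotient of exponentials is
[expR (- k * N)] from the far parameters divided by [expR (- (k / 2) * N)] from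
the evidence. *)
Lemma posterior_expect_bound (h : H) (Y Y' : 'rV[R]_d -> R) (M1 M delta : R) :
  measurable_fun Xi Y -> measurable_fun Xi Y' ->
  (forall x, Xi x -> `|Y x| <= M1) -> (forall x, Xi x -> `|Y' x| <= M) ->
  (forall x, Xi x -> `|Y x - Y' x| <= delta) -> 0 <= M ->
  `|posterior_expect Xi Theta varpi f p N xs hs h Y - true_expect Xi q h Y'| <=
  delta + M * (e + 2 * #|H|%:R * expR (- (k / 2) * N%:R) / (c2 * v)).
Proof.
move=> mY mY' YM1 YM Yd M0.
pose fh x := f x h.
have fh_density t : Theta t -> is_density Xi (fh^~ t) by exact: f_density.
have fh_continuous x : Xi x -> {within Theta, continuous (fh x)}.
  exact: f_continuous.
pose G t := \int[muX]_(x in Xi) (Y x * f x h t).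
have mul_int (Y0 : 'rV[R]_d -> R) (C0 : R) t :
    measurable_fun Xi Y0 -> (forall x, Xi x -> `|Y0 x| <= C0) ->
    Theta t -> muX.-integrable Xi (fun x => (Y0 x * f x h t)%:E).
  move=> mY0 YC Tt; apply: (bounded_mul_integrable mXi mY0 YC).
  exact: (density_integrable fh_density).
have mul_le (Y0 : 'rV[R]_d -> R) (C0 : R) t :
    measurable_fun Xi Y0 -> (forall x, Xi x -> `|Y0 x| <= C0) ->
    Theta t -> `|\int[muX]_(x in Xi) (Y0 x * f x h t)| <= C0.
  move=> mY0 YC Tt; have [mf f0 _] := fh_density t Tt.
  have iY := mul_int _ _ _ mY0 YC Tt.
  apply: (le_trans (le_normr_Rintegral mXi iY)).
  have -> : C0 = \int[muX]_(x in Xi) (C0 * f x h t).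
    rewrite RintegralZl//; last exact: (density_integrable fh_density).
    by rewrite (Rintegral_density fh_density Tt) mulr1.
  apply: le_Rintegral => //; first exact: (integrable_norm iY).
    exact: (mul_int (cst C0) `|C0|).
  by move=> x Xx; rewrite normrM (ger0_norm (f0 x Xx)) ler_wpM2r ?YC// f0.
have trueE : true_expect Xi q h Y' = \int[muX]_(x in Xi) (Y' x * f x h ts).
  by apply: eq_Rintegral => x /[!inE] Xx; rewrite well_specified.
set G' := true_expect _ _ _ _ in trueE *.
have expectE : posterior_expect Xi Theta varpi f p N xs hs h Y =
    \int[muT]_(t in Theta) (post t * G t).
  apply: eq_Rintegral => t /[!inE] Tt.
  rewrite [RHS]mulrC /G /post; move: (posterior _ _ _ _ _ _ _ t) => c.
  by rewrite RintegralZr//; exact: (mul_int _ _ _ mY YM1).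
have mG : measurable_fun Theta G.
  apply: measurable_fun_within_continuous => //.
  exact: (integral_mul_density_continuous mXi fh_density fh_continuous mY YM1).
have mpost : measurable_fun Theta post by apply/measurable_EFinP; exact: measurable_int ipost.
have iG (C1 : R) (B1 : 'rV[R]_s -> R) : measurable_fun Theta B1 ->
    (forall t, Theta t -> `|B1 t| <= C1) ->
    muT.-integrable Theta (fun t => (post t * B1 t)%:E).
  move=> mB BC; under eq_fun do rewrite mulrC.
  exact: (bounded_mul_integrable mTheta mB BC).
have GM1 t : Theta t -> `|G t| <= M1 by exact: mul_le.
have iGG : muT.-integrable Theta (fun t => (post t * (G t - G'))%:E).
  apply: (iG (M1 + `|G'|)); first exact: measurable_funB.
  by move=> t Tt; rewrite (le_trans (ler_normB _ _))// lerD2r GM1.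
have -> : posterior_expect Xi Theta varpi f p N xs hs h Y - G' =
    \int[muT]_(t in Theta) (post t * (G t - G')).
  rewrite expectE; under [RHS]eq_Rintegral do rewrite mulrBr.
  rewrite RintegralB//; last 2 first.
  - exact: (iG M1).
  - by apply: (iG `|G'|).
  by rewrite RintegralZr// int_post mul1r.
apply: (le_trans (le_normr_Rintegral mTheta iGG)).
pose K := 2 * #|H|%:R * expR (- k * N%:R) / Z N.
have ia : muT.-integrable Theta (fun t => ((delta + M * e) * post t)%:E).
  by under eq_fun do rewrite EFinM; exact: integrableZl.
have ib : muT.-integrable Theta (fun t => (M * K * p t)%:E).
  by under eq_fun do rewrite EFinM; exact: integrableZl.
have ibound : muT.-integrable Theta
    (fun t => ((delta + M * e) * post t + M * K * p t)%:E).
  by under eq_fun do rewrite EFinD; exact: integrableD.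
apply: (@le_trans _ _ (\int[muT]_(t in Theta)
    ((delta + M * e) * post t + M * K * p t))).
  apply: le_Rintegral => //; first exact: (integrable_norm iGG).
  move=> t Tt; rewrite normrM (ger0_norm (post_ge0 Tt)).
  have GG : `|G t - G'| <= delta + M * D t.
    rewrite (_ : G t - G' = (G t - \int[muX]_(x in Xi) (Y' x * f x h t)) +
      (\int[muX]_(x in Xi) (Y' x * f x h t) - G')); last by ring.
    apply: (le_trans (ler_normD _ _)); apply: lerD.
      rewrite /G -RintegralB//; last 2 first.
      - exact: (mul_int _ _ _ mY YM1).
      - exact: (mul_int _ _ _ mY' YM).
      under eq_Rintegral do rewrite -mulrBl.
      by apply: (mul_le (fun x => Y x - Y' x)) => //; exact: measurable_funB.
    rewrite trueE.
    apply: (le_trans (integral_mul_density_dist mXi fh_density mY' YM Tt Tts)).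
    rewrite ler_wpM2l// /D /model_dist (bigD1 h)//= lerDl sumr_ge0// => h' _.
    exact: L1_dist_ge0.
  apply: (le_trans (ler_wpM2l (post_ge0 Tt) GG)).
  have := ler_wpM2l M0 (post_dist Tt); rewrite -/K; lra.
rewrite RintegralD// !RintegralZl// int_post.
have -> : \int[muT]_(t in Theta) p t = 1.
  by have [_ _ p1] := p_density; rewrite /Rintegral p1.
rewrite !mulr1 mulrDr addrA lerD2l ler_wpM2l// /K -!mulrA.
rewrite ler_wpM2l// ler_wpM2l//.
rewrite ler_pdivrMr//.
apply: (@le_trans _ _ (expR (- (k / 2) * N%:R) / (c2 * v) *
   (expR (- (k / 2) * N%:R) * c2 * v))); last first.
  by rewrite ler_wpM2l// divr_ge0 ?expR_ge0// mulr_ge0 ?(ltW c2_gt0) ?(ltW v_gt0).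
rewrite le_eqVlt; apply/orP; left; apply/eqP.
have -> : expR (- k * N%:R) = expR (- (k / 2) * N%:R) * expR (- (k / 2) * N%:R).
  by rewrite -expRD; congr expR; lra.
by field; rewrite !gt_eqF.
Qed.

End posterior_bound.

(** * Stability of the Bellman equation *)

Lemma inf_image_dist (R : realType) T (U : set T) (a b : T -> R) (r m : R) :
  U !=set0 -> (forall u, U u -> `|a u - b u| <= r) ->
  (forall u, U u -> m <= b u) ->
  `|inf [set a u | u in U] - inf [set b u | u in U]| <= r.
Proof.
move=> [u0 Uu0] abr mb.
have bb : has_inf [set b u | u in U].
  by split; [exists (b u0), u0|exists m => _ [u Uu <-]; exact: mb].
have ba : has_inf [set a u | u in U].
  split; first by exists (a u0), u0.
  exists (m - r) => _ [u Uu <-].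
  by have := abr u Uu; rewrite ler_distl => /andP[]; have := mb u Uu; lra.
rewrite ler_distl; apply/andP; split.
  apply: lb_le_inf; first exact: ba.1.
  move=> _ [u Uu <-].
  have h : inf [set b u | u in U] <= b u by apply: ge_inf; [exact: bb.2|exists u].
  by have := abr u Uu; rewrite ler_distl => /andP[]; lra.
rewrite -lerBlDr; apply: lb_le_inf; first exact: bb.1.
move=> _ [u Uu <-].
have h : inf [set a u | u in U] <= a u by apply: ge_inf; [exact: ba.2|exists u].
by have := abr u Uu; rewrite ler_distl => /andP[]; lra.
Qed.

Section bellman_stability.
Context (R : realType) (H : finType) (n m d : nat) (gamma : R).
Context (X : set 'rV[R]_n) (U : set 'rV[R]_m) (Xi : set 'rV[R]_d).
Context (varpi : H -> H -> R).
Context (c : 'rV[R]_n -> 'rV[R]_m -> 'rV[R]_d -> R).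
Context (F : 'rV[R]_n -> 'rV[R]_m -> 'rV[R]_d -> 'rV[R]_n).
Context (varpi_stochastic : stochastic varpi) (gamma01 : 0 < gamma < 1).
Context (U_nonempty : U !=set0) (Mc : R).
Context (c_le : forall x u y, X x -> U u -> Xi y -> `|c x u y| <= Mc).
Context (F_stable : forall x u y, X x -> U u -> Xi y -> X (F x u y)).

Let gamma0 : 0 <= gamma. Proof. by case/andP: gamma01 => /ltW. Qed.

Let avg_le (V : H -> R) h M : (forall h', `|V h'| <= M) ->
  `|\sum_h' varpi h h' * V h'| <= M.
Proof.
move=> VM; have [v0 v1] := varpi_stochastic.
apply: (le_trans (ler_norm_sum _ _ _)).
rewrite -[leRHS]mul1r -(v1 h) mulr_suml; apply: ler_sum => h' _.
by rewrite normrM ger0_norm// ler_wpM2l.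
Qed.

Lemma cost_to_go_le V M x u h y : (forall x h, X x -> `|V x h| <= M) ->
  X x -> U u -> Xi y ->
  `|cost_to_go gamma varpi c F V x u h y| <= Mc + gamma * M.
Proof.
move=> VM Xx Uu Xy; apply: (le_trans (ler_normD _ _)).
apply: lerD; first exact: c_le.
rewrite normrM (ger0_norm gamma0) ler_wpM2l//; apply: avg_le => h'.
by apply: VM; exact: F_stable.
Qed.

Lemma cost_to_go_dist V W M x u h y : (forall x h, X x -> `|V x h - W x h| <= M) ->
  X x -> U u -> Xi y ->
  `|cost_to_go gamma varpi c F V x u h y - cost_to_go gamma varpi c F W x u h y|
  <= gamma * M.
Proof.
move=> VM Xx Uu Xy; rewrite /cost_to_go opprD addrACA subrr add0r -mulrBr -sumrB normrM.
rewrite (ger0_norm gamma0) ler_wpM2l//.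
under eq_bigr do rewrite -mulrBr.
by apply: avg_le => h'; apply: VM; exact: F_stable.
Qed.

(** The contraction argument.  The two expectation operators are compared only on
the bounded integrands that occur; the slack [delta] absorbs the distance
between the two solutions and is multiplied by [gamma]. *)
Lemma sup_dist_bellman_le (E1 E2 : H -> ('rV[R]_d -> R) -> R)
    (V W : 'rV[R]_n -> H -> R) (MW r : R) :
  (forall h (Y Y' : 'rV[R]_d -> R) M1 delta,
    measurable_fun Xi Y -> measurable_fun Xi Y' ->
    (forall x, Xi x -> `|Y x| <= M1) ->
    (forall x, Xi x -> `|Y' x| <= Mc + gamma * MW) ->
    (forall x, Xi x -> `|Y x - Y' x| <= delta) ->
    `|E1 h Y - E2 h Y'| <= delta + r) ->
  (forall h (Y' : 'rV[R]_d -> R), measurable_fun Xi Y' ->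
    (forall x, Xi x -> `|Y' x| <= Mc + gamma * MW) ->
    `|E2 h Y'| <= Mc + gamma * MW) ->
  (forall x h, X x -> `|W x h| <= MW) -> 0 <= r ->
  bellman_solution gamma X U Xi varpi c F E1 V ->
  bellman_solution gamma X U Xi varpi c F E2 W ->
  0 <= sup_dist X V W <= r / (1 - gamma).
Proof.
move=> E12 E2M WM r0 [[MV VM] mV VE] [_ mW WE].
have g1 : 0 < 1 - gamma by have /andP[] := gamma01; lra.
rewrite /sup_dist; set S := [set _ | _ in _].
have [->|/set0P S0] := eqVneq S set0; first by rewrite sup0 lexx divr_ge0// ltW.
have supS : has_sup S.
  split => //; exists (MV + MW) => _ [[x h] [/= Xx _] <-].
  by apply: (le_trans (ler_normB _ _)); apply: lerD; [exact: VM|exact: WM].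
have S_ub x h : X x -> `|V x h - W x h| <= sup S.
  by move=> Xx; apply: sup_upper_bound => //; exists (x, h).
apply/andP; split.
  by case: S0 => y Sy; apply: le_trans (sup_upper_bound supS Sy); case: Sy => z _ <-.
rewrite ler_pdivlMr//.
suff : sup S <= gamma * sup S + r by lra.
apply: ge_sup => // _ [[x h] [/= Xx _] <-].
rewrite VE// WE//.
apply: (@inf_image_dist _ _ _ _ _ _ (- (Mc + gamma * MW))) => // u Uu.
  apply: (E12 _ _ _ (Mc + gamma * MV)); [exact: mV|exact: mW| | |] => y Xy.
  - exact: cost_to_go_le.
  - exact: cost_to_go_le.
  - exact: cost_to_go_dist.
have := E2M h (cost_to_go gamma varpi c F W x u h) (mW x u h Xx Uu).
move=> /(_ (fun y Xy => cost_to_go_le h WM Xx Uu Xy)).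
by rewrite ler_norml => /andP[].
Qed.

End bellman_stability.

(** * Convergence of the value functions *)

Lemma true_expect_le (R : realType) (H : finType) d (Xi : set 'rV[R]_d)
    (q : 'rV[R]_d -> H -> R) h (Y : 'rV[R]_d -> R) (M : R) :
  measurable Xi -> (forall h, is_density Xi (q^~ h)) -> measurable_fun Xi Y ->
  (forall x, Xi x -> `|Y x| <= M) -> `|true_expect Xi q h Y| <= M.
Proof.
move=> mXi q_density mY YM; have [mq q0 q1] := q_density h.
have iq := is_density_integrable (q_density h).
have iY : (lebesgue_rV R d).-integrable Xi (fun x => (Y x * q x h)%:E).
  exact: (bounded_mul_integrable mXi mY YM).
apply: (le_trans (le_normr_Rintegral mXi iY)).
have iM : (lebesgue_rV R d).-integrable Xi (fun x => (M * q x h)%:E).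
  by under eq_fun do rewrite EFinM; exact: integrableZl.
have -> : M = \int[lebesgue_rV R d]_(x in Xi) (M * q x h).
  by rewrite RintegralZl// [X in _ * X](_ : _ = 1) ?mulr1// /Rintegral q1.
apply: le_Rintegral => //; first exact: (integrable_norm iY).
by move=> x Xx; rewrite normrM (ger0_norm (q0 x Xx)) ler_wpM2r ?YM// q0.
Qed.

(** Positivity makes integrability under the stationary law equivalent to
integrability in every state. *)
Lemma stationary_gt0 (R : realType) (H : finType) (varpi : H -> H -> R) nu h :
  stochastic varpi -> irreducible_chain varpi -> stationary varpi nu -> 0 < nu h.
Proof.
move=> st irr [nu0 nu1 nuE].
have nuk k h' : \sum_a nu a * nstep varpi k a h' = nu h'.
  elim: k => [|k IH] /=.
    rewrite (bigD1 h')//= eqxx mulr1 big1 ?addr0// => a /negbTE ->.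
    by rewrite mulr0.
  rewrite -[RHS]IH; under eq_bigr do rewrite mulr_sumr.
  rewrite exchange_big /=; apply: eq_bigr => l _.
  by rewrite -nuE mulr_suml; apply: eq_bigr => a _; rewrite mulrA.
have : \sum_a nu a <> 0 by rewrite nu1; apply/eqP; exact: oner_neq0.
move=> /psumr_neq0P[a _|a /= nua]; first exact: nu0.
have [k kP] := irr a h.
rewrite -(nuk k h) (bigD1 a)//= ltr_pwDl ?mulr_gt0// sumr_ge0// => b _.
by rewrite mulr_ge0// nstep_ge0.
Qed.

Theorem proposition3p1 (R : realType) (n m d s : nat) (H : finType)
  (* data-generating process *)
  (disp : measure_display) (Omega : measurableType disp)
  (P : probability Omega R)
  (Xi : set 'rV[R]_d) (varpi : H -> H -> R) (q : 'rV[R]_d -> H -> R)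
  (eta1 : H) (xi : nat -> Omega -> 'rV[R]_d) (eta : nat -> Omega -> H)
  (Xi_closed : closed Xi)
  (varpi_stochastic : stochastic varpi)
  (q_density : forall h, is_density Xi (q^~ h))
  (data : data_process Xi varpi q P eta1 xi eta)
  (nu : H -> R) (nu_stationary : stationary varpi nu)
  (* parametric model and prior *)
  (Theta : set 'rV[R]_s) (f : 'rV[R]_d -> H -> 'rV[R]_s -> R)
  (p : 'rV[R]_s -> R)
  (f_density : forall h theta, Theta theta ->
    is_density Xi (fun x => f x h theta))
  (p_density : is_density Theta p)
  (* control problem *)
  (gamma : R) (gamma01 : 0 < gamma < 1)
  (X : set 'rV[R]_n) (U : set 'rV[R]_m) (U_nonempty : U !=set0)
  (c : 'rV[R]_n -> 'rV[R]_m -> 'rV[R]_d -> R)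
  (c_measurable : measurable_fun setT
    (fun z : 'rV[R]_n * 'rV[R]_m * 'rV[R]_d => c z.1.1 z.1.2 z.2))
  (c_bounded : exists M, forall x u y, X x -> U u -> Xi y -> `|c x u y| <= M)
  (F : 'rV[R]_n -> 'rV[R]_m -> 'rV[R]_d -> 'rV[R]_n)
  (F_measurable : measurable_fun setT
    (fun z : 'rV[R]_n * 'rV[R]_m * 'rV[R]_d => F z.1.1 z.1.2 z.2))
  (F_stable : forall x u y, X x -> U u -> Xi y -> X (F x u y))
  (* true and Bayesian value functions *)
  (Vstar : 'rV[R]_n -> H -> R)
  (Vstar_bellman : unique_bellman_solution gamma X U Xi varpi c F
    (true_expect Xi q) Vstar)
  (VN : nat -> Omega -> 'rV[R]_n -> H -> R)
  (VN_bellman : {ae P, forall w, forall N, (0 < N)%N ->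
    unique_bellman_solution gamma X U Xi varpi c F
      (posterior_expect Xi Theta varpi f p N
         (fun i => xi i w) (fun i => eta i w))
      (VN N w)})
  (* (i) *)
  (Theta_convex : @convex_set R 'rV[R]_s Theta)
  (Theta_compact : compact Theta)
  (Theta_interior : Theta° !=set0)
  (* (ii) *)
  (c1 c2 : R) (c2_gt0 : 0 < c2) (c2_le_c1 : c2 <= c1)
  (p_bounds : forall theta, Theta theta -> c2 <= p theta <= c1)
  (* (iii) *)
  (f_gt0 : forall x h theta, Xi x -> Theta theta -> 0 < f x h theta)
  (* (iv) *)
  (f_continuous : forall x h, Xi x -> {within Theta, continuous (f x h)})
  (* (v) *)
  (varpi_irreducible : irreducible_chain varpi)
  (varpi_aperiodic : aperiodic_chain varpi)
  (* (vi) *)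
  (log_dominated : exists g : 'rV[R]_d -> H -> R,
    Pstar_integrable Xi q nu g /\
    forall x h theta, Xi x -> Theta theta -> `|ln (f x h theta)| <= g x h)
  (* (vii) *)
  (thetas : 'rV[R]_s) (thetas_interior : Theta° thetas)
  (well_specified : forall h x, Xi x -> q x h = f x h thetas)
  (identifiable : forall theta, Theta theta ->
    (forall h x, Xi x -> f x h thetas = f x h theta) -> theta = thetas) :
  {ae P, forall w,
    (fun N => sup_dist X (VN N w) Vstar) @ \oo --> (0 : R)}.
Proof.
have mXi := closed_measurable_rV Xi_closed.
have mTheta : measurable Theta.
  by apply: closed_measurable_rV; apply: compact_closed => //; exact: norm_hausdorff.
have Tts : Theta thetas by exact: interior_subset.
have [g [[mg g_sum] ln_g]] := log_dominated.
have nu_gt0 h := stationary_gt0 h varpi_stochastic varpi_irreducible nu_stationary.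
have g_integrable h :
    (\int[lebesgue_rV R d]_(x in Xi) (`|g x h| * q x h)%:E < +oo)%E.
  rewrite ltNge leye_eq; apply/negP => /eqP gy; move: g_sum.
  rewrite (bigD1 h)//= gy gt0_muley ?lte_fin// addye// ?ltxx//.
  rewrite -ltNye; apply: (@lt_le_trans _ _ 0%E) => //; apply: sume_ge0 => h' _.
  rewrite mule_ge0 ?lee_fin ?(ltW (nu_gt0 h'))//; apply: integral_ge0 => x Xx.
  by have [_ q0 _] := q_density h'; rewrite lee_fin mulr_ge0// q0.
(* Null sets depend on the accuracy, so it ranges over a sequence. *)
pose lr w := log_ratio f thetas (xi^~ w) (eta^~ w).
have far j : exists k : R, 0 < k /\ {ae P, forall w, \forall N \near \oo,
    forall t, Theta t -> model_dist Xi f thetas t < j.+1%:R^-1 \/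
      lr w N t <= - k * N%:R}.
  have j0 : 0 < (j.+1%:R^-1 : R) by rewrite invr_gt0.
  have [k k0 kP] := ae_uniform_log_ratio_decay Xi_closed q_density
    varpi_stochastic varpi_irreducible data f_density Theta_compact f_gt0
    f_continuous mg g_integrable ln_g Tts well_specified j0.
  by exists k.
have [k kP] := choice far.
have near_ts j : exists A : set 'rV[R]_s, [/\ measurable A, A `<=` Theta,
    (0 < lebesgue_rV R s A)%E, (lebesgue_rV R s A < +oo)%E &
    {ae P, forall w, \forall N \near \oo, forall t, A t ->
      - (k j / 2) * N%:R <= lr w N t}].
  have k0 : 0 < k j / 2 by rewrite divr_gt0// (kP j).1.
  have [B nB BP] := ae_log_ratio_ge Xi_closed q_density data f_density
    f_gt0 f_continuous mg g_integrable ln_g Tts k0.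
  have [A [mA AB A0 Ay]] := nbhs_rV_pos_measure (filterI nB thetas_interior).
  exists A; split => //; first by move=> t /AB[].
  by apply: filterS BP => w; apply: filterS => N h t /AB[Bt Tt]; exact: h.
have [A AP] := choice near_ts.
have ae_far := ae_foralln (fun j => (kP j).2).
have ae_near : {ae P, forall w, forall j, \forall N \near \oo, forall t, A j t ->
    - (k j / 2) * N%:R <= lr w N t}.
  by apply: ae_foralln => j; have [] := AP j.
have ae_pos := ae_transition_gt0 varpi_stochastic data.
have [Mc0 c_le0] := c_bounded.
pose Mc := Num.max Mc0 0.
have c_le x u y : X x -> U u -> Xi y -> `|c x u y| <= Mc.
  by move=> Xx Uu Xy; rewrite le_max c_le0.
have [Vsol _] := Vstar_bellman; have [[MV0 VM0] _ _] := Vsol.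
pose MV := Num.max MV0 0.
have VM x h : X x -> `|Vstar x h| <= MV by move=> Xx; rewrite le_max VM0.
pose M := Mc + gamma * MV.
have M0 : 0 <= M.
  have /andP[g0 _] := gamma01.
  by rewrite addr_ge0 ?mulr_ge0 ?(ltW g0)// le_max lexx orbT.
have g1 : 0 < 1 - gamma by have /andP[_] := gamma01; lra.
apply: filterS2 (filterI ae_far ae_near) (filterI ae_pos VN_bellman).
move=> w [wfar wnear] [wpos wbell].
apply/cvgrPdist_le => e e0.
(* Chosen so that [M * (e' + e')] is at most the admissible error
   [e * (1 - gamma)] in the expectations; [M + 1] avoids a division by 0. *)
pose e' := e * (1 - gamma) / (2 * (M + 1)).
have M1 : 0 < M + 1 by rewrite ltr_wpDl.
have e'0 : 0 < e' by rewrite divr_gt0 ?mulr_gt0.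
have [j _ /(_ j (leqnn _)) /= je] := near_infty_natSinv_lt (PosNum e'0).
have [kj0 _] := kP j; have [mA AT A0 Ay _] := AP j.
pose v := fine (lebesgue_rV R s (A j)).
have v0 : 0 < v by rewrite fine_gt0// A0.
pose K := 2 * #|H|%:R / (c2 * v).
have K0 : 0 <= K by rewrite divr_ge0 ?mulr_ge0 ?(ltW c2_gt0) ?(ltW v0).
have expsmall : \forall N \near \oo, K * expR (- (k j / 2) * N%:R) < e'.
  near=> N.
  have : K / e' / (k j / 2) < N%:R by near: N; exact: nbhs_infty_gtr.
  rewrite ltr_pdivrMr ?divr_gt0// ltr_pdivrMr// => KN.
  rewrite mulNr expRN ltr_pdivrMr ?expR_gt0//.
  apply: (lt_le_trans KN); rewrite mulrC ler_wpM2l ?(ltW e'0)//.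
  have := expR_ge1Dx (k j / 2 * N%:R); lra.
near=> N.
have N0 : (0 < N)%N by near: N; exact: nbhs_infty_gt.
have [VNsol _] := wbell N N0.
pose r := M * (j.+1%:R^-1 + 2 * #|H|%:R * expR (- (k j / 2) * N%:R) / (c2 * v)).
have r0 : 0 <= r.
  rewrite mulr_ge0// addr_ge0 ?invr_ge0// divr_ge0 ?mulr_ge0 ?expR_ge0//.
    exact: ltW.
  exact: ltW.
have bound : 0 <= sup_dist X (VN N w) Vstar <= r / (1 - gamma).
  apply: (sup_dist_bellman_le varpi_stochastic gamma01 U_nonempty c_le F_stable
    _ _ VM r0 VNsol Vsol) => [h Y Y' M2 delta mY mY' YM YM' Yd|h Y' mY' YM']; last first.
    exact: true_expect_le.
  have p_ge t : Theta t -> c2 <= p t by move=> /p_bounds /andP[].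
  have Lfar : forall t, Theta t -> model_dist Xi f thetas t < j.+1%:R^-1 \/
      lr w N t <= - k j * N%:R by near: N; exact: wfar.
  have Lnear : forall t, A j t -> - (k j / 2) * N%:R <= lr w N t.
    by near: N; exact: wnear.
  have j0 : 0 < (j.+1%:R^-1 : R) by rewrite invr_gt0.
  exact: (posterior_expect_bound mXi mTheta f_density p_density c2_gt0 p_ge f_gt0
    f_continuous ln_g Tts well_specified (fun i => xi_in_Xi data i w) wpos N0 j0
    mA AT A0 Ay Lfar Lnear h mY mY' YM YM' Yd M0).
have /andP[b0 b1] := bound.
rewrite sub0r normrN ger0_norm//; apply: (le_trans b1).
rewrite ler_pdivrMr//.
have re : r <= M * (e' + e').
  rewrite /r ler_wpM2l//; apply: lerD; first exact: ltW.
  have : K * expR (- (k j / 2) * N%:R) < e' by near: N.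
  by rewrite /K mulrAC => /ltW.
apply: (le_trans re).
have -> : M * (e' + e') = e * (1 - gamma) * (M / (M + 1)).
  by rewrite /e'; field; rewrite gt_eqF.
rewrite ler_piMr ?mulr_ge0 ?(ltW e0) ?(ltW g1)//.
by rewrite ler_pdivrMr// mul1r lerDl.
Unshelve. all: by end_near.
Qed.
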